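(* Let $X$ be a Fréchet space and let $\Gamma:[0,1]\to ck(X)$ be Bochner measurable. Then $\Gamma$ is Pettis integrable in $ck(X)$ if and only if for each equicontinuous set $K\subseteq X^*$ the family $\{\sigma(x^*,\Gamma(\cdot)):x^*\in K\}$ is uniformly integrable on $[0,1]$.
   Context: $X$ is a Fréchet space with topology generated by an increasing sufficient sequence of seminorms $(p_i)$ and metric $d(x,y)=\sum_i2^{-i}\frac{p_i(x-y)}{1+p_i(x-y)}$; $X^*$ its dual. $ck(X)$: nonempty compact convex subsets; $cb(X)$: nonempty closed bounded convex subsets; $H$ the Hausdorff metric induced by $d$. $\sigma(x^*,C)=\sup_{x\in C}\langle x^*,x\rangle$. Lebesgue measure $\mu$ on $[0,1]$. Bochner measurable: there are simple multifunctions $\Gamma_n=\sum_j\chi_{A_j}C_j$ ($A_j$ pairwise disjoint measurable, $C_j\in cb(X)$) with $H(\Gamma_n(t),\Gamma(t))\to0$ a.e. Pettis integrable in $ck(X)$: $\sigma(x^*,\Gamma(\cdot))$ is Lebesgue integrable for each $x^*\in X^*$, and for every measurable $E$ there is $x_E\in ck(X)$ with $\sigma(x^*,x_E)=\int_E\sigma(x^*,\Gamma(t))dt$ for all $x^*\in X^*$. *)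

(* Defs.v *)
From HB Require Import structures.
From mathcomp Require Import all_boot all_order all_algebra.
From mathcomp Require Import all_classical all_reals all_analysis.
Set Implicit Arguments. Unset Strict Implicit. Unset Printing Implicit Defensive.
Import Order.TTheory GRing.Theory Num.Theory numFieldNormedType.Exports.
Local Open Scope classical_set_scope.
Local Open Scope ring_scope.

Section frechet_seminorms.
Variables (R : realType) (X : lmodType R) (p : nat -> X -> R).

Definition is_seminorm (q : X -> R) : Prop :=
  (forall x y, q (x + y) <= q x + q y) /\ (forall (a : R) x, q (a *: x) = `|a| * q x).

Definition fdist (x y : X) : R :=
  limn (fun n => \sum_(i < n) ((2 ^- i.+1) * (p i (x - y) / (1 + p i (x - y))))).

Definition d_cauchy (u : nat -> X) : Prop :=
  forall eps : R, 0 < eps -> exists N, forall m n, (N <= m)%N -> (N <= n)%N ->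
    fdist (u m) (u n) < eps.

Definition d_converges (u : nat -> X) (x : X) : Prop :=
  (fun n => fdist (u n) x) @ \oo --> (0 : R).

Definition frechet_seminorms : Prop :=
  [/\ forall i, is_seminorm (p i),
      forall i x, p i x <= p i.+1 x,
      forall x, (forall i, p i x = 0) -> x = 0
    & forall u, d_cauchy u -> exists x, d_converges u x].

Definition d_open (U : set X) : Prop :=
  forall x, U x -> exists2 r : R, 0 < r & forall y, fdist x y < r -> U y.

Definition d_closed (C : set X) : Prop :=
  forall x, (forall eps : R, 0 < eps -> exists2 y, C y & fdist x y < eps) -> C x.

Definition d_compact (C : set X) : Prop :=
  forall F : set (set X), (forall U, F U -> d_open U) ->
    C `<=` \bigcup_(U in F) U ->
    exists s : seq (set X), (forall U, U \in s -> F U) /\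
      C `<=` \big[setU/set0]_(U <- s) U.

Definition tvs_bounded (C : set X) : Prop :=
  forall eps : R, 0 < eps -> exists2 t : R, 0 < t &
    forall x, C x -> fdist (t *: x) 0 < eps.

Definition fconvex (C : set X) : Prop :=
  forall x y (t : R), C x -> C y -> 0 <= t -> t <= 1 -> C (t *: x + (1 - t) *: y).

Definition ck (C : set X) : Prop := C !=set0 /\ d_compact C /\ fconvex C.
Definition cb (C : set X) : Prop :=
  [/\ C !=set0, d_closed C, tvs_bounded C & fconvex C].

Definition dist_to (x : X) (B : set X) : R := inf [set fdist x b | b in B].
Definition fexcess (A B : set X) : R := sup [set dist_to a B | a in A].
Definition fhausdorff (A B : set X) : R := Num.max (fexcess A B) (fexcess B A).

Definition fdual (f : X -> R) : Prop :=
  (forall (a : R) x y, f (a *: x + y) = a * f x + f y) /\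
  (forall x (eps : R), 0 < eps -> exists2 delta : R, 0 < delta &
     forall y, fdist x y < delta -> `|f x - f y| < eps).

Definition equicont_dual (K : set (X -> R)) : Prop :=
  K `<=` fdual /\
  (forall x (eps : R), 0 < eps -> exists2 delta : R, 0 < delta &
     forall f y, K f -> fdist x y < delta -> `|f x - f y| < eps).

Definition supportf (f : X -> R) (C : set X) : R := sup [set f x | x in C].

End frechet_seminorms.

Notation mu := (@completed_lebesgue_measure _).

Section multifunctions.
Local Open Scope ereal_scope.
Variables (R : realType) (X : lmodType R) (p : nat -> X -> R).

Definition lebT := caratheodory_type (R:=R)
  (T:=lebesgue_stieltjes_measure_ocitv_type__canonical__measurable_structure_SemiRingOfSets R)
  (wlength idfun)^*%mu.

Definition I01 : set lebT := `[0%R, 1%R].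

(** value at t of the simple multifunction sum_j chi_{A_j} C_j
    (A_j pairwise disjoint), with chi_A C = C on A and {0} off A *)
Definition simple_mf (k : nat) (A : 'I_k -> set lebT) (C : 'I_k -> set X)
  (t : lebT) : set X :=
  [set x | (exists j, A j t /\ C j x) \/ ((forall j, ~ A j t) /\ x = 0%R)].

Definition bochner_measurable (G : lebT -> set X) : Prop :=
  exists (k : nat -> nat) (A : forall n, 'I_(k n) -> set lebT)
         (C : forall n, 'I_(k n) -> set X),
    [/\ forall n j, measurable (A n j) /\ A n j `<=` I01,
        forall n i j, i != j -> A n i `&` A n j = set0,
        forall n j, cb p (C n j)
      & {ae mu, forall t, I01 t ->
          (fun n => fhausdorff p (simple_mf (A n) (C n) t) (G t)) @ \oo --> 0%R}].

Definition pettis_integrable_ck (G : lebT -> set X) : Prop :=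
  (forall f, fdual p f -> mu.-integrable I01 (fun t => (supportf f (G t))%:E)) /\
  (forall E, measurable E -> E `<=` I01 ->
     exists xE, ck p xE /\
       forall f, fdual p f -> (supportf f xE)%:E = \int[mu]_(t in E) (supportf f (G t))%:E).

Definition uniformly_integrable (F : set (lebT -> R)) : Prop :=
  [/\ forall g, F g -> mu.-integrable I01 (fun t => (g t)%:E),
      exists M : R, forall g, F g -> \int[mu]_(t in I01) `|g t|%:E <= M%:E
    & forall eps : R, (0 < eps)%R -> exists2 delta : R, (0 < delta)%R &
        forall E, measurable E -> E `<=` I01 -> mu E < delta%:E ->
          forall g, F g -> \int[mu]_(t in E) `|g t|%:E < eps%:E].

End multifunctions.

(* Main.v *)
Require Import Defs.
From HB Require Import structures.
From mathcomp Require Import all_boot all_order all_algebra.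
From mathcomp Require Import all_classical all_reals all_analysis.
From mathcomp Require Import measurable_realfun ring lra.
Set Implicit Arguments. Unset Strict Implicit. Unset Printing Implicit Defensive.
Import Order.TTheory GRing.Theory Num.Theory numFieldNormedType.Exports.
Local Open Scope classical_set_scope.
Local Open Scope ring_scope.

(** Every equicontinuous set of functionals lies in the polar [K_n] of one of
    the seminorms [q_n = (n+1) p_n], and every such polar is equicontinuous.

    Necessity.  Put [nu_f (E) = \int_E sigma(f, G)].  If [f_k] is a sequence in
    [K_n] and [f] its pointwise limit along an ultrafilter, then
    [sigma(f_k, C)] tends to [sigma(f, C)] for every compact [C], in particular
    for the Pettis integral of [G] over [E], so [nu_(f_k) (E)] tends to
    [nu_f (E)].  A Vitali-Hahn-Saks gliding hump turns this compactness into
    equi-absolute continuity of [{nu_f : f in K_n}].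

    Sufficiency.  Bochner measurability splits [[0,1]], up to a set of small
    measure, into finitely many pieces on which [G] oscillates by at most [e]
    for [q_n]; uniform integrability makes the exceptional set harmless.  So
    [f |-> \int_E sigma(f, G)] is, uniformly on [K_n], close to the support
    function of a finite Minkowski sum of multiples of values of [G].  By
    Hahn-Banach and completeness, a functional that can be approximated in this
    way for all [n] is the support function of a compact convex set. *)

(** * Negative powers of two *)

Section dyadic_numbers.
Variable R : realType.

Lemma pow2N_gt0 n : 0 < 2 ^- n :> R.
Proof. by rewrite invr_gt0 exprn_gt0. Qed.

Lemma pow2NS n : 2 ^- n = 2 ^- n.+1 + 2 ^- n.+1 :> R.
Proof. by rewrite exprS invfM; field; rewrite expf_neq0. Qed.

Lemma exists_pow2N_lt (e : R) : 0 < e -> exists n, 2 ^- n < e.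
Proof.
move=> e0.
have /cvgrPdist_lt /(_ e e0) := @cvg_expr R 2^-1 ltac:(rewrite ger0_norm; lra).
move=> [n _ /(_ n (leqnn n))] /=.
by rewrite sub0r normrN exprVn ger0_norm ?ltW//; exists n.
Qed.

Lemma ler_pow2N m n : (m <= n)%N -> 2 ^- n <= 2 ^- m :> R.
Proof. by move=> mn; rewrite lef_pV2 ?posrE ?exprn_gt0// ler_eXn2l// ltr1n. Qed.

End dyadic_numbers.

(** * Hahn-Banach theorem for sublinear functionals *)

Section hahn_banach.
Variables (R : realType) (X : lmodType R).
Implicit Types (s f : X -> R) (B : set X) (x y b : X).

Definition sublinear s :=
  (forall x y, s (x + y) <= s x + s y) /\
  (forall a x, 0 < a -> s (a *: x) <= a * s x).

Definition linear_form f := forall (a : R) x y, f (a *: x + y) = a * f x + f y.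

Lemma sublinear0 s : sublinear s -> s 0 = 0.
Proof.
move=> [_ sZ]; have := sZ 2 0 (ltr0Sn _ _); have := sZ 2^-1 0; rewrite !scaler0.
by move=> /(_ ltac:(lra)); lra.
Qed.

Lemma sublinearZ s a x : sublinear s -> 0 <= a -> s (a *: x) = a * s x.
Proof.
move=> ss; rewrite le_eqVlt => /predU1P[<-|a0].
  by rewrite scale0r mul0r sublinear0.
apply/eqP; rewrite eq_le ss.2//=.
have := ss.2 a^-1 (a *: x); rewrite invr_gt0 => /(_ a0).
by rewrite scalerA mulVf ?gt_eqF// scale1r mulrC ler_pdivlMr// mulrC.
Qed.

Lemma sublinear_geN s x : sublinear s -> - s (- x) <= s x.
Proof.
move=> ss; have := ss.1 x (- x); rewrite subrr sublinear0//; lra.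
Qed.

(** The functional is [s' x = inf (s (x + l *: b) - l * r)] over [l >= 0] and [b] in [B]. Taking
    [l = 0] gives [s' <= s], taking [x = - b] and [l = 1] gives the bound on [- B], and [r <= s] on
    [B] keeps the infimum above [- s (- x)]. A singleton [B] yields linearity of minimal
    functionals, a general convex [B] yields separation. *)
Lemma sublinear_tilt s B (r : R) : sublinear s -> B !=set0 -> fconvex B ->
  (forall b, B b -> r <= s b) ->
  exists s', [/\ sublinear s', forall x, s' x <= s x &
    forall b, B b -> s' (- b) <= - r].
Proof.
move=> ss [b0 Bb0] cB Br.
pose V x := [set v | exists l b, [/\ 0 <= l, B b & v = s (x + l *: b) - l * r]].
have lbV x : lbound (V x) (- s (- x)).
  move=> _ [l [b [l0 Bb ->]]].
  have := ss.1 (x + l *: b) (- x); rewrite addrAC subrr add0r sublinearZ//.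
  have := ler_wpM2l l0 (Br _ Bb); lra.
have hV x : has_inf (V x).
  split; last by exists (- s (- x)).
  by exists (s (x + 0 *: b0) - 0 * r), 0, b0.
have leV x v : V x v -> inf (V x) <= v.
  by apply: ge_inf; case: (hV x).
have addV x y v w : V x v -> V y w -> exists2 u, V (x + y) u & u <= v + w.
  move=> [l [b [l0 Bb ->]]] [m [c [m0 Bc ->]]].
  (* Subadditivity rests on writing [l *: b + m *: c] as [l + m] times a convex combination of [b]
     and [c], which requires [l + m] to be nonzero. *)
  have [lm0|lm0] := eqVneq (l + m) 0.
    have -> : l = 0 by lra.
    have -> : m = 0 by lra.
    exists (s (x + y + 0 *: b0) - 0 * r); first by exists 0, b0.
    by rewrite !scale0r !addr0; have := ss.1 x y; lra.
  have lmp : 0 < l + m by rewrite lt_neqAle eq_sym lm0; lra.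
  pose t := l / (l + m); have t1 : 1 - t = m / (l + m).
    by rewrite /t; field.
  have Bbc : B (t *: b + (1 - t) *: c).
    apply: cB => //; first by rewrite divr_ge0// ltW.
    by rewrite -subr_ge0 t1 divr_ge0// ltW.
  exists (s (x + y + (l + m) *: (t *: b + (1 - t) *: c)) - (l + m) * r).
    by exists (l + m), (t *: b + (1 - t) *: c); split => //; lra.
  rewrite t1 scalerDr !scalerA /t [(l + m) * (l / _)]mulrC divfK//.
  rewrite [(l + m) * (m / _)]mulrC divfK// addrACA.
  have := ss.1 (x + l *: b) (y + m *: c); lra.
exists (fun x => inf (V x)); split.
- split => [x y|a x a0].
    apply/ler_addgt0Pr => e e0.
    have e20 : 0 < e / 2 by lra.
    have [v Vv vl] := inf_adherent e20 (hV x).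
    have [w Vw wl] := inf_adherent e20 (hV y).
    have [u Vu uvw] := addV _ _ _ _ Vv Vw.
    have := leV _ _ Vu; lra.
  rewrite mulrC -ler_pdivrMr//; apply: lb_le_inf; first by case: (hV x).
  move=> _ [l [b [l0 Bb ->]]]; rewrite ler_pdivrMr//.
  have /leV/le_trans -> // : V (a *: x) (s (a *: x + (a * l) *: b) - (a * l) * r).
    by exists (a * l), b; rewrite mulr_ge0 ?(ltW a0).
  rewrite -scalerA -scalerDr (sublinearZ _ ss (ltW a0)); lra.
- move=> x; apply: leV; exists 0, b0; split => //.
  by rewrite scale0r addr0 mul0r subr0.
- move=> b Bb; apply: leV; exists 1, b; split => //.
  by rewrite scale1r addNr sublinear0// mul1r sub0r.
Qed.

(** Zorn's lemma for the reversed pointwise order. A nonempty chain is bounded by its pointwise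
    infimum, which is finite because every member stays above [- s (- x)], and subadditive because
    any two members are comparable. *)
Lemma sublinear_minimal s : sublinear s -> exists m,
  [/\ sublinear m, forall x, m x <= s x &
    forall m', sublinear m' -> (forall x, m' x <= m x) -> m' = m].
Proof.
move=> ss.
pose T := {m : X -> R | sublinear m /\ forall x, m x <= s x}.
pose rel (m m' : T) := `[< forall x, sval m' x <= sval m x >].
pose mk m (h : sublinear m /\ forall x, m x <= s x) : T := exist _ m h.
have t0 : T by exists s.
have [|u v w /asboolP uv /asboolP vw|[u pu] [v pv] /asboolP/= uv /asboolP/= vu||
  [m [sm ms]] mmin] := @Zorn T rel.
- by move=> t; apply/asboolP.
- by apply/asboolP => x; exact: le_trans (uv x).
- by apply: eq_exist; apply/funext => x; apply/eqP; rewrite eq_le vu uv.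
(* The empty chain is bounded by [s] itself. *)
- move=> A totA; have [[a0 Aa0]|/set0P/negP/negPn/eqP A0] := pselect (A !=set0); last first.
    by exists t0 => u; rewrite A0.
  pose V x := [set sval u x | u in A].
  have hV x : has_inf (V x).
    split; first by exists (sval a0 x), a0.
    exists (- s (- x)) => _ [[u [su us]] Au <-]/=.
    by have := sublinear_geN x su; have := us (- x); lra.
  have leV x u : A u -> inf (V x) <= sval u x.
    by move=> Au; apply: ge_inf; [case: (hV x)|exists u].
  have sV : sublinear (fun x => inf (V x)).
    split => [x y|a x a0'].
      apply/ler_addgt0Pr => e e0; have e20 : 0 < e / 2 by lra.
      have [_ [u Au <-] ul] := inf_adherent e20 (hV x).
      have [_ [v Av <-] vl] := inf_adherent e20 (hV y).
      have [/asboolP|/asboolP] := totA _ _ Au Av => uv.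
        have := leV (x + y) _ Av; have := (svalP v).1.1 x y; have := uv x; lra.
      have := leV (x + y) _ Au; have := (svalP u).1.1 x y; have := uv y; lra.
    rewrite mulrC -ler_pdivrMr//; apply: lb_le_inf; first by case: (hV x).
    move=> _ [u Au <-]; rewrite ler_pdivrMr//.
    by rewrite (le_trans (leV _ _ Au))// mulrC; exact: (svalP u).1.2.
  have Vs x : inf (V x) <= s x by rewrite (le_trans (leV _ _ Aa0))//; exact: (svalP a0).2.
  by exists (mk _ (conj sV Vs)) => u Au; apply/asboolP => x /=; exact: leV.
- exists m; split => // m' sm' m'm.
  have m's x : m' x <= s x by exact: le_trans (ms x).
  have /mmin : rel (mk m (conj sm ms)) (mk m' (conj sm' m's)) by apply/asboolP.
  by move=> /(congr1 sval).
Qed.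

(** A minimal sublinear functional [m] is linear: tilting it along the singleton of [y] at height
    [m y] cannot change it, so [m (- y) = - m y], and an odd sublinear functional is linear. *)
Lemma hahn_banach_sublinear s : sublinear s ->
  exists2 f, linear_form f & forall x, f x <= s x.
Proof.
move=> /sublinear_minimal[m [sm ms mmin]]; exists m => //.
have mN y : m (- y) = - m y.
  have [|x z t -> -> _ _|b -> //|s' [ss' s'm /(_ _ erefl)]] :=
      @sublinear_tilt m [set y] (m y) sm.
  - by exists y.
  - by rewrite /= -scalerDl addrC subrK scale1r.
  - rewrite (mmin _ ss' s'm) => myN.
    by apply/eqP; rewrite eq_le myN; have := sublinear_geN y sm; lra.
have mD x y : m (x + y) = m x + m y.
  apply/eqP; rewrite eq_le sm.1/=.
  by have := sm.1 (x + y) (- y); rewrite addrK mN; lra.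
move=> a x y; rewrite mD; congr (_ + _).
have [a0|/ltW a0] := leP 0 a; first exact: sublinearZ.
rewrite -[a]opprK scaleNr mN sublinearZ ?oppr_ge0//; lra.
Qed.

(** Tilt [q] along the convex set [x - A], where it is at least [r]. A linear form below the tilted
    functional is dominated by [q] and is at most [- r] on [A - x]. *)
Lemma hahn_banach_separation (q : X -> R) (A : set X) (r : R) x :
  is_seminorm q -> A !=set0 -> fconvex A -> (forall a, A a -> r <= q (x - a)) ->
  exists f, [/\ linear_form f, forall y, `|f y| <= q y &
    forall a, A a -> f a + r <= f x].
Proof.
move=> [qD qZ] [a0 Aa0] cA Ar.
have sq : sublinear q.
  by split => // a y a0'; rewrite qZ gtr0_norm.
have [|b c t [b' Ab' <-] [c' Ac' <-] t0 t1|b [a Aa <-]|s' [ss' s'q s'r]] :=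
    @sublinear_tilt q [set x - a | a in A] r sq; last first.
- have [f lf fs'] := hahn_banach_sublinear ss'.
  have f0 : f 0 = 0 by have := lf 1 0 0; rewrite scale1r addr0; lra.
  have fD y z : f (y + z) = f y + f z by rewrite -[y]scale1r lf mul1r scale1r.
  have fN y : f (- y) = - f y by have := fD y (- y); rewrite subrr f0; lra.
  exists f; split => // [y|a Aa].
    rewrite ler_norml (le_trans (fs' y))// andbT.
    have := le_trans (fs' (- y)) (s'q (- y)).
    by rewrite fN -scaleN1r qZ normrN1 mul1r; lra.
  have := le_trans (fs' _) (s'r (x - a) ltac:(by exists a)).
  by rewrite fN fD fN; lra.
- exact: Ar.
- exists (t *: b' + (1 - t) *: c'); first exact: cA.
  rewrite !scalerBr addrACA -scalerDl addrC [t + _]addrC subrK scale1r.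
  by rewrite opprD addrC.
- by exists (x - a0), a0.
Qed.

End hahn_banach.

(** * Seminorms, linear forms and polars *)

Section seminorms.
Variables (R : realType) (X : lmodType R).
Implicit Types (q f : X -> R) (A B : set X) (x y : X).

Lemma seminorm0 q : is_seminorm q -> q 0 = 0.
Proof. by move=> [_ qZ]; rewrite -(scale0r 0) qZ normr0 mul0r. Qed.

Lemma seminormN q x : is_seminorm q -> q (- x) = q x.
Proof. by move=> [_ qZ]; rewrite -scaleN1r qZ normrN1 mul1r. Qed.

Lemma seminormB q x y : is_seminorm q -> q (x - y) = q (y - x).
Proof. by move=> sq; rewrite -seminormN// opprB. Qed.

Lemma seminorm_ge0 q x : is_seminorm q -> 0 <= q x.
Proof.
move=> sq; have := sq.1 x (- x); rewrite subrr seminorm0// seminormN//; lra.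
Qed.

Lemma seminorm_triangle q x y z : is_seminorm q -> q (x - z) <= q (x - y) + q (y - z).
Proof. by move=> sq; have := sq.1 (x - y) (y - z); rewrite addrA subrK. Qed.

Lemma linear_formB f x y : linear_form f -> f (x - y) = f x - f y.
Proof.
move=> lf; have := lf (-1) y x; rewrite scaleN1r addrC => ->; lra.
Qed.

Lemma linear_form0 f : linear_form f -> f 0 = 0.
Proof. by move=> lf; rewrite -(subrr 0) linear_formB// subrr. Qed.

Lemma linear_formZ f a x : linear_form f -> f (a *: x) = a * f x.
Proof. by move=> lf; have := lf a x 0; rewrite addr0 linear_form0// addr0. Qed.

Lemma linear_formD f x y : linear_form f -> f (x + y) = f x + f y.
Proof. by move=> lf; have := lf 1 x y; rewrite scale1r mul1r. Qed.

Definition polar q : set (X -> R) :=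
  [set f | linear_form f /\ forall x, `|f x| <= q x].

Lemma polar_le q f x : polar q f -> f x <= q x.
Proof. by move=> [_ fq]; exact: le_trans (ler_norm _) (fq x). Qed.

Lemma polarB q f x y : polar q f -> f x <= f y + q (x - y).
Proof.
by move=> Kf; have := polar_le (x - y) Kf; rewrite linear_formB; [lra|exact: Kf.1].
Qed.

End seminorms.

(** * Comparison of the metric with the seminorms *)

Section frechet_metric.
Variables (R : realType) (X : lmodType R) (p : nat -> X -> R).
Hypothesis fp : frechet_seminorms p.

Let sp i : is_seminorm (p i). Proof. by case: fp. Qed.

Lemma frechet_mono m n x : (m <= n)%N -> p m x <= p n x.
Proof.
case: fp => _ p_mono _ _; elim: n => [|n IH]; first by rewrite leqn0 => /eqP ->.
rewrite leq_eqVlt ltnS => /predU1P[->//|/IH pm].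
exact: le_trans (p_mono n x).
Qed.

Let term (x y : X) i := 2 ^- i.+1 * (p i (x - y) / (1 + p i (x - y))).
Let psum x y n := \sum_(i < n) term x y i.

Let frac_bound (t : R) : 0 <= t -> [/\ 0 <= t / (1 + t), t / (1 + t) <= t & t / (1 + t) <= 1].
Proof.
move=> t0; have h : 0 < 1 + t by lra.
split; first by rewrite divr_ge0// ltW.
- by rewrite ler_pdivrMr//; nra.
- by rewrite ler_pdivrMr//; lra.
Qed.

Let term_ge0 x y i : 0 <= term x y i.
Proof.
rewrite mulr_ge0 ?(ltW (pow2N_gt0 R _))//.
by case: (frac_bound (seminorm_ge0 (x - y) (sp i))).
Qed.

Let psum_mono x y : nondecreasing_seq (psum x y).
Proof.
apply/nondecreasing_seqP => n.
by rewrite /psum big_ord_recr/= lerDl term_ge0.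
Qed.

(** The sum is split at index [i]. Up to [i] each fraction is at most [p i (x - y)] by monotonicity,
    and the weights add up to [1 - 2 ^- i.+1]; beyond [i] the fractions are at most 1 and the
    weights add up to at most [2 ^- i.+1]. *)
Let psum_le x y i n : psum x y n <= p i (x - y) + 2 ^- i.+1.
Proof.
have p0 := seminorm_ge0 (x - y) (sp i).
have S1 k : (k <= i.+1)%N -> psum x y k <= (1 - 2 ^- k) * p i (x - y).
  elim: k => [|k IH] ki; first by rewrite /psum big_ord0 expr0 invr1 subrr mul0r.
  rewrite /psum big_ord_recr/= -/(psum x y k).
  have := IH (ltnW ki); rewrite (pow2NS R k).
  have [_ h _] := frac_bound (seminorm_ge0 (x - y) (sp k)).
  have := le_trans h (frechet_mono (x - y) (ki : (k <= i)%N)).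
  move=> /(ler_wpM2l (ltW (pow2N_gt0 R k.+1))); rewrite -/(term x y k); nra.
have S2 k : psum x y (i.+1 + k)%N <= p i (x - y) + 2 ^- i.+1 - 2 ^- (i.+1 + k).
  elim: k => [|k IH].
    by rewrite addn0; have := S1 _ (leqnn i.+1); have := pow2N_gt0 R i.+1; nra.
  rewrite addnS /psum big_ord_recr/= -/(psum x y (i.+1 + k)).
  have [_ _ h] := frac_bound (seminorm_ge0 (x - y) (sp (i.+1 + k)%N)).
  move: h => /(ler_wpM2l (ltW (pow2N_gt0 R (i.+1 + k).+1))); rewrite mulr1.
  have := pow2NS R (i.+1 + k)%N; move: IH.
  rewrite -/(term x y (i.+1 + k)%N); lra.
apply: (le_trans (psum_mono x y (leq_addl i.+1 n))).
by apply: (le_trans (S2 n)); rewrite gerBl ltW.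
Qed.

Let cvg_psum x y : cvgn (psum x y).
Proof.
apply: nondecreasing_is_cvgn; first exact: psum_mono.
by exists (p 0%N (x - y) + 2 ^- 1) => _ [n _ <-]; exact: psum_le.
Qed.

Lemma fdist_le x y i : fdist p x y <= p i (x - y) + 2 ^- i.+1.
Proof.
apply: limr_le; first exact: cvg_psum.
by apply: nearW => n; exact: psum_le.
Qed.

Lemma fdist_le1 x y : fdist p x y <= 1.
Proof.
have S1 k : psum x y k <= 1 - 2 ^- k.
  elim: k => [|k IH]; first by rewrite /psum big_ord0 expr0 invr1 subrr.
  rewrite /psum big_ord_recr/= -/(psum x y k).
  have [_ _ h] := frac_bound (seminorm_ge0 (x - y) (sp k)).
  move: h => /(ler_wpM2l (ltW (pow2N_gt0 R k.+1))); rewrite mulr1.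
  have := pow2NS R k; rewrite -/(term x y k); lra.
apply: limr_le; first exact: cvg_psum.
by apply: nearW => n; apply: (le_trans (S1 n)); rewrite gerBl ltW.
Qed.

Lemma fdist_ge x y i : 2 ^- i.+1 * (p i (x - y) / (1 + p i (x - y))) <= fdist p x y.
Proof.
have h := nondecreasing_cvgn_le (@psum_mono x y) (@cvg_psum x y) i.+1.
apply: le_trans h; rewrite /psum big_ord_recr/= lerDr.
by apply: sumr_ge0 => j _; exact: term_ge0.
Qed.

Lemma fdist_ge0 x y : 0 <= fdist p x y.
Proof. exact: le_trans (term_ge0 x y 0) (fdist_ge x y 0). Qed.

Lemma fdist_small_seminorm i (e : R) : 0 < e ->
  exists2 d : R, 0 < d & forall x y, fdist p x y < d -> p i (x - y) < e.
Proof.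
move=> e0; have e1 : 0 < 1 + e by lra.
(* This is the [i]-th term of the metric when the seminorm equals [e], and [t / (1 + t)] increases
   with [t]. *)
exists (2 ^- i.+1 * (e / (1 + e))); first by rewrite mulr_gt0 ?divr_gt0.
move=> x y /(le_lt_trans (fdist_ge x y i)); rewrite ltr_pM2l//.
have t0 := seminorm_ge0 (x - y) (sp i).
rewrite ltr_pdivrMr; last lra.
rewrite mulrAC ltr_pdivlMr//; nra.
Qed.

Lemma seminorm_small_fdist (e : R) : 0 < e ->
  exists i, exists2 d : R, 0 < d & forall x y, p i (x - y) < d -> fdist p x y < e.
Proof.
move=> e0; have e20 : 0 < e / 2 by lra.
have [i ie] := exists_pow2N_lt e20; have := ler_pow2N R (leqnSn i).
exists i, (e / 2) => // x y xy; have := fdist_le x y i; lra.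
Qed.

End frechet_metric.

(** * Calibrated seminorms: equicontinuity, completeness and compactness *)

Section calibrated_seminorms.
Variables (R : realType) (X : lmodType R) (p : nat -> X -> R).
Hypothesis fp : frechet_seminorms p.

(* With the factor [n.+1] every equicontinuous set lies in a single polar. *)
Definition sn n x := n.+1%:R * p n x.

Lemma sn_seminorm n : is_seminorm (sn n).
Proof.
have [pD pZ] : is_seminorm (p n) by case: fp.
split => [x y|a x]; first by rewrite /sn -mulrDr ler_wpM2l.
by rewrite /sn pZ mulrCA.
Qed.

Lemma sn_mono m n x : (m <= n)%N -> sn m x <= sn n x.
Proof.
move=> mn; apply: ler_pM => //; last exact: frechet_mono.
- by apply: seminorm_ge0; case: fp.
- by rewrite ler_nat.
Qed.

Lemma fdist_small_sn n (e : R) : 0 < e ->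
  exists2 d : R, 0 < d & forall x y, fdist p x y < d -> sn n (x - y) < e.
Proof.
move=> e0; have en : 0 < e / n.+1%:R by rewrite divr_gt0.
have [d d0 h] := fdist_small_seminorm fp n en.
by exists d => // x y /h; rewrite /sn ltr_pdivlMr// mulrC.
Qed.

Lemma sn_small_fdist (e : R) : 0 < e ->
  exists n, exists2 d : R, 0 < d & forall x y, sn n (x - y) < d -> fdist p x y < e.
Proof.
move=> /(seminorm_small_fdist fp)[n [d d0 h]]; exists n, d => // x y xy.
apply: h; apply: le_lt_trans xy; rewrite /sn ler_peMl// ?ler1n//.
by apply: seminorm_ge0; case: fp.
Qed.

Definition sn_cvg (u : nat -> X) x :=
  forall n (e : R), 0 < e -> exists N, forall m, (N <= m)%N -> sn n (u m - x) < e.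

Lemma sn_complete (u : nat -> X) :
  (forall n (e : R), 0 < e -> exists N, forall m k, (N <= m)%N -> (N <= k)%N ->
     sn n (u m - u k) < e) ->
  exists x, sn_cvg u x.
Proof.
move=> cu; have [_ _ _ /(_ u)[e e0|x ux]] := fp.
  have [n [d d0 h]] := sn_small_fdist e0; have [N hN] := cu n d d0.
  by exists N => m k Nm Nk; apply: h; exact: hN.
exists x => n e e0; have [d d0 h] := fdist_small_sn n e0.
move: ux => /cvgrPdist_lt/(_ d d0)[N _ hN]; exists N => m Nm; apply: h.
by have := hN _ Nm; rewrite /= sub0r normrN ger0_norm// fdist_ge0.
Qed.

(** Equicontinuity at 0 with tolerance 1 gives a ball [p i < c] on which every member of [K] is
    bounded by 1. By homogeneity the members are bounded by [c^-1 * p i], and [n] is taken above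
    both [i] and [c^-1]. *)
Lemma equicont_sub_polar K : equicont_dual p K -> exists n, K `<=` polar (sn n).
Proof.
move=> [Kd /(_ 0 1 ltr01)[d d0 Kc]].
have [i [c c0 ic]] := seminorm_small_fdist fp d0.
have p0 n x : 0 <= p n x by apply: seminorm_ge0; case: fp.
pose n := maxn i (Num.bound (c^-1)).
have cn : c^-1 <= n.+1%:R.
  have c'0 : 0 <= c^-1 by rewrite invr_ge0 ltW.
  have /ltW/le_trans -> // := archi_boundP c'0.
  by rewrite ler_nat (leq_trans (leq_maxr _ _) (leqnSn _)).
exists n => f Kf; have lf : linear_form f by exact: (Kd _ Kf).1.
split => // x; apply: (@le_trans _ _ (c^-1 * p i x)); last first.
  apply: ler_pM => //; first by rewrite invr_ge0 ltW.
  by apply: frechet_mono => //; exact: leq_maxl.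
(* Since [p i x] may vanish, [x] is scaled into the ball by means of [p i x + c * e], which is
   positive. *)
apply/ler_addgt0Pr => e e0; have s0 : 0 < p i x + c * e.
  by rewrite ltr_wpDl// mulr_gt0.
pose t := c / (p i x + c * e); have t0 : 0 < t by rewrite divr_gt0.
have : p i (0 - t *: x) < c.
  have si : is_seminorm (p i) by case: fp.
  rewrite sub0r seminormN// si.2 gtr0_norm// /t mulrAC ltr_pdivrMr//.
  by rewrite ltr_pM2l// ltrDl mulr_gt0.
move=> /ic/(Kc _ _ Kf); rewrite linear_form0// sub0r normrN linear_formZ//.
rewrite normrM gtr0_norm// mulrC -ltr_pdivlMr// => /ltW/le_trans; apply.
by rewrite /t invf_div mul1r mulrDl [c * e]mulrC mulfK ?gt_eqF// mulrC.
Qed.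

Lemma polar_equicont n : equicont_dual p (polar (sn n)).
Proof.
have eq x (e : R) : 0 < e -> exists2 d : R, 0 < d &
    forall f y, polar (sn n) f -> fdist p x y < d -> `|f x - f y| < e.
  move=> /(fdist_small_sn n)[d d0 h]; exists d => // f y [lf fq] /h.
  by rewrite -linear_formB//; exact: le_lt_trans.
split=> // f Kf; split; first exact: Kf.1.
by move=> x e /(eq x)[d d0 h]; exists d => // y; exact: h.
Qed.

Lemma fdual_polarP f : fdual p f <-> exists n, polar (sn n) f.
Proof.
split=> [[lf fc]|[n Kf]]; last exact: (polar_equicont n).1.
have [|n h] := @equicont_sub_polar [set f]; last by exists n; exact: h.
split => [_ -> //|x e e0]; have [d d0 h] := fc x e e0.
by exists d => // _ y -> /h.
Qed.

(** The seminorm grows along with the index, so a geometric bound on the steps controls every fixed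
    seminorm eventually. The tail after [j], measured in the [j]-th seminorm of the list, is the
    geometric series with sum [2 * c * 2 ^- j]. *)
Lemma sn_geometric_cvg (u : nat -> X) N (c : R) : 0 <= c ->
  (forall j, sn (N + j) (u j.+1 - u j) <= c * 2 ^- j) ->
  exists2 x, sn_cvg u x & forall j, sn (N + j) (x - u j) <= 2 * c * 2 ^- j.
Proof.
move=> c0 uc.
have tail j k : sn (N + j) (u (j + k)%N - u j) <= 2 * c * (2 ^- j - 2 ^- (j + k)).
  elim: k => [|k IH]; first by rewrite addn0 !subrr mulr0 seminorm0//; exact: sn_seminorm.
  have := seminorm_triangle (u (j + k.+1)%N) (u (j + k)%N) (u j) (sn_seminorm (N + j)).
  have le_j : (N + j <= N + (j + k))%N by rewrite leq_add2l leq_addr.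
  have := sn_mono (u (j + k).+1 - u (j + k)%N) le_j.
  have := uc (j + k)%N; have := pow2NS R (j + k); rewrite addnS.
  set a := 2 ^- j; set b := 2 ^- (j + k); set b' := 2 ^- (j + k).+1 => bb'.
  have -> : c * b = 2 * c * b - 2 * c * b' by rewrite bb'; ring.
  by move: IH; rewrite -/a -/b; lra.
have cau n (e : R) : 0 < e -> exists M, forall m, (M <= m)%N -> sn n (u m - u M) < e.
  move=> e0; have e1 : 0 < e / (2 * c + 1) by rewrite divr_gt0//; lra.
  have [M hM] := exists_pow2N_lt e1; exists (maxn n M) => m Mm.
  have nN : (n <= N + maxn n M)%N by rewrite (leq_trans (leq_maxl n M))// leq_addl.
  apply: le_lt_trans (sn_mono _ nN) _; rewrite -(subnKC Mm).
  apply: le_lt_trans (tail _ _) _.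
  have := le_lt_trans (ler_pow2N R (leq_maxr n M)) hM; rewrite ltr_pdivlMr; last lra.
  have := pow2N_gt0 R (maxn n M); have := pow2N_gt0 R (maxn n M + (m - maxn n M)); nra.
have [n e e0|x ux] := @sn_complete u.
  have e20 : 0 < e / 2 by lra.
  have [M hM] := cau n _ e20; exists M => m k /hM mM /hM kM.
  have := seminorm_triangle (u m) (u M) (u k) (sn_seminorm n).
  rewrite (seminormB (u M) (u k) (sn_seminorm n)); lra.
exists x => // j; apply/ler_addgt0Pr => e e0.
have [M /(_ _ (leq_addl j M))] := ux (N + j)%N e e0.
have := seminorm_triangle x (u (j + M)%N) (u j) (sn_seminorm (N + j)).
rewrite (seminormB x (u (j + M)%N) (sn_seminorm _)).
have := tail j M; have := mulr_ge0 c0 (ltW (pow2N_gt0 R (j + M))); lra.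
Qed.

Definition totally_bounded (q : X -> R) (A : set X) := forall e : R, 0 < e ->
  exists s : seq X, forall x, A x -> exists2 y, y \in s & q (x - y) < e.

Lemma d_compact_totally_bounded n A : d_compact p A -> totally_bounded (sn n) A.
Proof.
move=> cA e e0; pose ball x := [set y | sn n (y - x) < e].
have ob x : d_open p (ball x).
  move=> y; rewrite {1}/ball/= => xy; have yx : 0 < e - sn n (y - x) by lra.
  have [d d0 h] := fdist_small_sn n yx; exists d => // z /h.
  rewrite (seminormB _ _ (sn_seminorm n)) /ball/= => yz.
  have := seminorm_triangle z y x (sn_seminorm n); lra.
have [_ [x _ <-]//||s [sF As]] := cA (range ball).
  move=> x Ax; exists (ball x); first by exists x.
  by rewrite /ball/= subrr seminorm0//; exact: sn_seminorm.
have /choice[c cP] : forall U, exists x, U \in s -> U = ball x.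
  by move=> U; have [/sF[x _ <-]|Us] := boolP (U \in s); [exists x|exists 0].
exists (map c s) => x Ax; have := As x Ax; rewrite -bigcup_seq => -[U /= Us Ux].
by exists (c U); [exact: map_f|move: Ux; rewrite {1}(cP _ Us)].
Qed.

(** If [A] had no finite subcover, total boundedness would give nested subsets without finite
    subcover whose diameters for [sn n] shrink like [2 ^- n]. Points chosen in them converge to some
    [x] in [A], and the open set of the cover around [x] contains one of these subsets whole. *)
Lemma totally_bounded_d_compact A : (forall n, totally_bounded (sn n) A) ->
  (forall u x, (forall k, A (u k)) -> sn_cvg u x -> A x) -> d_compact p A.
Proof.
move=> tA clA F Fo AF; apply: contrapT => bad0.
pose fin B := exists s : seq (set X), (forall U, U \in s -> F U) /\
  B `<=` \big[setU/set0]_(U <- s) U.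
have {}bad0 : ~ fin A by [].
(* The hypotheses on [B] stand under the existential so that choice gives a total function; when
   they fail, [B] itself serves as a dummy value. *)
have step n B : exists C, B `<=` A -> ~ fin B ->
    [/\ C `<=` B, ~ fin C & forall x y, C x -> C y -> sn n (x - y) <= 2 ^- n].
  have [[BA nB]|h] := pselect (B `<=` A /\ ~ fin B); last by exists B => ? ?; exfalso; apply: h.
  have [s hs] := tA n (2 ^- n.+1) (pow2N_gt0 R _).
  pose C y := B `&` [set x | sn n (x - y) < 2 ^- n.+1].
  have [[y ys nC]|h'] := pselect (exists2 y, y \in s & ~ fin (C y)).
    exists (C y) => _ _; split => // [x []//|x z [_ /= xy] [_ /= zy]].
    have := seminorm_triangle x y z (sn_seminorm n).
    by rewrite (seminormB y z (sn_seminorm n)) (pow2NS R n); lra.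
  exfalso; apply: nB.
  have /choice[t tP] : forall y, exists t : seq (set X), y \in s ->
      (forall U, U \in t -> F U) /\ C y `<=` \big[setU/set0]_(U <- t) U.
    move=> y; have [ys|_] := boolP (y \in s); last by exists [::].
    by have [[t ht]|nC] := pselect (fin (C y)); [exists t|exfalso; apply: h'; exists y].
  exists (flatten [seq t y | y <- s]); split => [U /flattenP[_ /mapP[y ys ->]]|x Bx].
    exact: (tP _ ys).1.
  have [y ys xy] := hs _ (BA _ Bx); have := (tP _ ys).2 x (conj Bx xy).
  rewrite -!bigcup_seq => -[U /= Ut Ux]; exists U => //=.
  by apply/flattenP; exists (t y) => //; exact: map_f.
have [g gP] := choice (fun nB => step nB.1 nB.2).
pose B := fix B n := if n is m.+1 then g (m, B m) else A.
have BP n : B n `<=` A /\ ~ fin (B n).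
  elim: n => [|n [BA nB]]; first by split=> // x.
  have [/= gB ng _] := gP (n, B n) BA nB.
  by split => // x /gB/BA.
have BS n : B n.+1 `<=` B n by have [/= gB _ _] := gP (n, B n) (BP n).1 (BP n).2.
have Bd n x y : B n.+1 x -> B n.+1 y -> sn n (x - y) <= 2 ^- n.
  by have [/= _ _ h] := gP (n, B n) (BP n).1 (BP n).2; exact: h.
have /choice[u uB] : forall n, exists x, B n.+1 x.
  move=> n; apply: contrapT => nB.
  apply: (BP n.+1).2; exists [::]; split => // x Bx; exfalso; apply: nB; by exists x.
(* Both [u j] and [u j.+1] lie in [B j.+1], whose diameter for [sn j] is at most [2 ^- j]. *)
have [j|x ux uj] := @sn_geometric_cvg u 0 1 ler01.
  by rewrite add0n mul1r; apply: Bd => //; exact: BS.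
have Ax : A x by apply: clA ux => k; exact: (BP k.+1).1.
have [U FU Ux] := AF _ Ax; have [d d0 dU] := Fo _ FU _ Ux.
have [n [e e0 ne]] := sn_small_fdist d0.
(* A point of [B k.+1] is within [2 ^- k] of [u k], which is within [2 * 2 ^- k] of [x]. *)
have e30 : 0 < e / 3 by lra.
have [M hM] := exists_pow2N_lt e30; pose k := maxn n M.
apply: (BP k.+1).2; exists [:: U]; split => [V|y By].
  by rewrite inE => /eqP ->.
rewrite big_seq1; apply: dU; apply: ne.
apply: le_lt_trans (sn_mono _ (leq_maxl n M)) _.
have := uj k; rewrite add0n mulr1 => xuk.
have := Bd _ _ _ (uB k) By => uky.
have := seminorm_triangle x (u k) y (sn_seminorm k).
have := le_lt_trans (ler_pow2N R (leq_maxr n M)) hM; rewrite -/k; lra.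
Qed.

End calibrated_seminorms.

(** * Support functions of totally bounded sets *)

Section support_functions.
Variables (R : realType) (X : lmodType R).
Implicit Types (q f : X -> R) (A B : set X).

Lemma totally_bounded_has_ubound q f A : totally_bounded q A -> polar q f ->
  has_ubound (f @` A).
Proof.
move=> tA Kf; have [s hs] := tA 1 ltr01.
exists (\sum_(y <- s) `|f y| + 1) => _ [x Ax <-].
have [y ys xy] := hs _ Ax.
have := polarB x y Kf; have := ler_norm (f y).
have : `|f y| <= \sum_(y <- s) `|f y|.
  by rewrite (big_rem y)//= lerDl sumr_ge0.
lra.
Qed.

Lemma supportf_ge f A x : has_ubound (f @` A) -> A x -> f x <= supportf f A.
Proof. by move=> bA Ax; apply: ub_le_sup => //; exists x. Qed.

Lemma supportf_le f A (M : R) : A !=set0 -> (forall x, A x -> f x <= M) ->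
  supportf f A <= M.
Proof.
move=> [x Ax] h; apply: ge_sup; first by exists (f x), x.
by move=> _ [y Ay <-]; exact: h.
Qed.

Lemma supportf_adherent f A (e : R) : has_ubound (f @` A) -> A !=set0 -> 0 < e ->
  exists2 x, A x & supportf f A - e < f x.
Proof.
move=> bA [x Ax] e0; have [|_ [y Ay <-] h] := @sup_adherent _ (f @` A) e e0.
  by split => //; exists (f x), x.
by exists y.
Qed.

Lemma supportf_eq f A (a : R) : A !=set0 -> (forall x, A x -> f x <= a) ->
  (forall e : R, 0 < e -> exists2 x, A x & a - e <= f x) -> supportf f A = a.
Proof.
move=> A0 Aa ha; apply/eqP; rewrite eq_le supportf_le//=.
apply/ler_addgt0Pr => e /ha[x Ax]; have : f x <= supportf f A.
  by apply: supportf_ge => //; exists a => _ [y /Aa ? <-].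
lra.
Qed.

(** Hausdorff closeness for a seminorm, stated with witnesses so that no supremum or infimum with a
    default value intervenes. *)
Definition close q (e : R) A B :=
  (forall a, A a -> exists2 b, B b & q (a - b) <= e) /\
  (forall b, B b -> exists2 a, A a & q (a - b) <= e).

Lemma closeC q e A B : is_seminorm q -> close q e A B -> close q e B A.
Proof.
move=> sq [AB BA]; split => [b /BA|a /AB] [c Cc ?];
by exists c; rewrite // seminormB.
Qed.

Lemma close_trans q e1 e2 A B C : is_seminorm q ->
  close q e1 A B -> close q e2 B C -> close q (e1 + e2) A C.
Proof.
move=> sq [AB BA] [BC CB]; split => [a /AB[b /BC[c Cc bc] ab]|c /CB[b /BA[a Aa ab] bc]].
  by exists c => //; have := seminorm_triangle a b c sq; lra.
by exists a => //; have := seminorm_triangle a b c sq; lra.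
Qed.

Lemma close_supportf q e f A B : is_seminorm q -> polar q f -> close q e A B ->
  B !=set0 -> has_ubound (f @` B) -> `|supportf f A - supportf f B| <= e.
Proof.
move=> sq Kf [AB BA] B0 bB; rewrite ler_distl; apply/andP.
have A0 : A !=set0 by have [b /BA[a Aa _]] := B0; exists a.
have fA x : A x -> f x <= supportf f B + e.
  move=> /AB[b Bb xb]; have := polarB x b Kf; have := supportf_ge bB Bb; lra.
split; last exact: supportf_le.
rewrite lerBlDr; apply: supportf_le => // b /BA[a Aa ab].
have bA : has_ubound (f @` A) by exists (supportf f B + e) => _ [x /fA ? <-].
have := polarB b a Kf; rewrite seminormB//; have := supportf_ge bA Aa; lra.
Qed.

(** A form of Banach-Alaoglu: the values at [x] stay in the compact segment from [- q x] to [q x],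
    so they converge along the ultrafilter. Members of the polar are 1-Lipschitz for [q], hence a
    finite net of [A] turns pointwise convergence into uniform convergence on [A], and suprema
    converge. *)
Lemma ultralimit_polar q (f_ : nat -> X -> R) (U : set_system nat) :
  UltraFilter U -> is_seminorm q -> (forall n, polar q (f_ n)) ->
  exists2 f, polar q f & forall A, A !=set0 -> totally_bounded q A ->
    (fun n => supportf (f_ n) A) @ U --> supportf f A.
Proof.
move=> UU sq Kf.
have /choice[f fP] : forall x, exists l : R, `|l| <= q x /\ (fun n => f_ n x) @ U --> l.
  move=> x; pose F := (fun n => f_ n x) @ U.
  have FI : F `[- q x, q x]%classic.
    by apply: (@filterE _ U) => n; rewrite /= in_itv/= -ler_norml; exact: (Kf n).2.
  have [l [lq cl]] := @segment_compact R (- q x) (q x) F _ FI.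
  exists l; split; first by move: lq; rewrite /= in_itv/= -ler_norml.
  (* An ultrafilter converges to each of its cluster points. *)
  move=> V lV; have [//|nV] := in_ultra_setVsetC ((fun n => f_ n x) @^-1` V) UU.
  by have [y []] := cl _ _ (nV : F (~` V)) lV.
have lf : linear_form f.
  move=> a x y; have [_ h1] := fP (a *: x + y).
  have [[_ hx] [_ hy]] := (fP x, fP y).
  have h2 : (fun n => a * f_ n x + f_ n y) @ U --> a * f x + f y.
    by apply: cvgD hy; apply: cvgM hx; exact: cvg_cst.
  have e : (fun n => f_ n (a *: x + y)) = (fun n => a * f_ n x + f_ n y).
    by apply/funext => n; exact: (Kf n).1.
  by rewrite e in h1; exact: (cvg_unique (@norm_hausdorff _ _) h1 h2).
have pf : polar q f by split => // x; exact: (fP x).1.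
exists f => // A A0 tA; apply/cvgrPdist_le => e e0.
have e30 : 0 < e / 3 by lra.
have [s hs] := tA _ e30.
have : \forall n \near U, forall y, y \in s -> `|f y - f_ n y| <= e / 3.
  elim: s {hs} => [|z s IH]; first by apply: filterE.
  have [_ /cvgrPdist_le/(_ _ e30) h] := fP z.
  by apply: filterS (filterI h IH) => n [hz hs] y; rewrite inE => /predU1P[->|/hs].
apply: filterS => n hn; rewrite ler_distl; apply/andP.
have bf : has_ubound (f @` A) := totally_bounded_has_ubound tA pf.
have bfn : has_ubound (f_ n @` A) := totally_bounded_has_ubound tA (Kf n).
split; last first.
  apply: supportf_le => // x Ax; have [y ys xy] := hs _ Ax.
  have := hn _ ys; rewrite ler_distl => /andP[_].
  have := polarB x y pf; have := polarB y x (Kf n); rewrite (seminormB y x)//.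
  have := supportf_ge bfn Ax; lra.
rewrite lerBlDr; apply: supportf_le => // x Ax; have [y ys xy] := hs _ Ax.
have := hn _ ys; rewrite ler_distl => /andP[h _].
have := polarB x y (Kf n); have := polarB y x pf; rewrite (seminormB y x)//.
have := supportf_ge bf Ax; lra.
Qed.

End support_functions.

(** * Compact convex sets recovered from their support functions *)

Section frechet_support.
Variables (R : realType) (X : lmodType R) (p : nat -> X -> R).
Hypothesis fp : frechet_seminorms p.
Notation sn := (sn p).

Lemma sn_cvg_continuous u x f : sn_cvg p u x -> (exists n, polar (sn n) f) ->
  forall e : R, 0 < e -> exists N, forall m, (N <= m)%N -> `|f (u m) - f x| < e.
Proof.
move=> ux [n [lf fq]] e /(ux n)[N hN]; exists N => m /hN.
by rewrite -linear_formB//; exact: le_lt_trans.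
Qed.

(** The set is the intersection [C] of the half-spaces [f x <= phi f]. Near-maximizers in [C] are
    limits of walks from each [I k] to [I k.+1], whose steps are geometric by Hahn-Banach. Total
    boundedness of [C] is inherited from the [I k], and its closedness comes from the
    half-spaces. *)
Lemma ck_of_approximable_support (phi : (X -> R) -> R) :
  (forall n (e : R), 0 < e -> exists I, [/\ I !=set0, fconvex I, totally_bounded (sn n) I &
     forall f, polar (sn n) f -> `|supportf f I - phi f| <= e]) ->
  exists C, ck p C /\ forall f, fdual p f -> supportf f C = phi f.
Proof.
move=> happrox.
have /choice[I IP] := fun n => happrox n _ (pow2N_gt0 R n).
pose C := [set x | forall n f, polar (sn n) f -> f x <= phi f].
have polarS m n f : (m <= n)%N -> polar (sn m) f -> polar (sn n) f.
  by move=> mn [lf fm]; split => // x; apply: le_trans (sn_mono fp x mn).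
have Isup n f x : polar (sn n) f -> I n x -> f x <= phi f + 2 ^- n.
  move=> Kf Ix; have [_ _ tI /(_ _ Kf)] := IP n; rewrite ler_distl => /andP[_].
  by apply: le_trans; apply: supportf_ge => //; exact: totally_bounded_has_ubound tI Kf.
(* Hahn-Banach: otherwise a functional separates [x] from [I n] by the margin [r]. *)
have Idist m n x (r : R) : (forall f, polar (sn m) f -> f x < supportf f (I n) + r) ->
    exists2 y, I n y & sn m (x - y) < r.
  move=> h; apply: contrapT => far; have [I0 cI tI _] := IP n.
  have [|f [lf fq fr]] := hahn_banach_separation (sn_seminorm fp m) I0 cI (r := r) (x := x).
    by move=> y Iy; rewrite leNgt; apply/negP => xy; apply: far; exists y.
  have := h _ (conj lf fq).
  have : supportf f (I n) <= f x - r by apply: supportf_le => // y /fr; lra.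
  lra.
(* On the polar of [sn k], passing from [I k] through [phi] to [I k.+1] costs [2 ^- k + 2 ^- k.+1],
   strictly below the margin [4 * 2 ^- k]. Off [I k] the value 0 is a dummy. *)
have /choice[s sP] : forall kx : nat * X, exists y, I kx.1 kx.2 ->
    I kx.1.+1 y /\ sn kx.1 (y - kx.2) <= 4 * 2 ^- kx.1.
  move=> [k x] /=; have [Ix|] := pselect (I k x); last by exists 0.
  have [|y Iy xy] := Idist k k.+1 x (4 * 2 ^- k).
    move=> f Kf; have [I0 cI tI hI] := IP k.+1.
    have := hI _ (polarS _ _ _ (leqnSn k) Kf); rewrite ler_distl => /andP[_].
    have := Isup _ _ _ Kf Ix.
    have := hI _ (polarS _ _ _ (leqnSn k) Kf); rewrite ler_distl => /andP[].
    by have := pow2NS R k; have := pow2N_gt0 R k; have := pow2N_gt0 R k.+1; lra.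
  by exists y => _; split => //; rewrite seminormB ?ltW//; exact: sn_seminorm.
have adh f (e : R) : fdual p f -> 0 < e -> exists2 x, C x & phi f - e <= f x.
  move=> /(fdual_polarP fp)[n Kf] e0.
  (* Ten errors [2 ^- N] add up: one from [phi f] to the supremum on [I N], one from there to
     [f x0], and eight for the whole walk from [x0] to [x]. *)
  have [M hM] : exists M, 2 ^- M < e / 10 by apply: exists_pow2N_lt; lra.
  pose N := maxn n M; have KN := polarS _ _ _ (leq_maxl n M) Kf.
  have hN := le_lt_trans (@ler_pow2N R _ _ (leq_maxr n M)) hM.
  have [I0 cI tI hI] := IP N.
  have [x0 Ix0 fx0] := supportf_adherent (totally_bounded_has_ubound tI KN) I0 (pow2N_gt0 R N).
  pose u := fix u j := if j is i.+1 then s ((N + i)%N, u i) else x0.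
  have Iu j : I (N + j)%N (u j).
    elim: j => [|j IH]; first by rewrite addn0.
    by have [+ _] := sP ((N + j)%N, u j) IH; rewrite addnS.
  have [||x ux uj] := @sn_geometric_cvg _ _ _ fp u N (4 * 2 ^- N).
  - by rewrite mulr_ge0// ltW.
  - move=> j; have [_ /=] := sP ((N + j)%N, u j) (Iu j).
    by rewrite exprD invfM mulrA.
  exists x; last first.
    have := uj 0%N; rewrite addn0 expr0 invr1 mulr1.
    have := polarB x0 x KN; rewrite (seminormB x0 x); last exact: sn_seminorm.
    have := hI _ KN; rewrite ler_distl => /andP[+ _].
    by move: fx0 hN; rewrite -/N /=; lra.
  (* The limit belongs to [C]: the [J]-th point of the walk lies in [I (N + J)] and violates the
     constraint of [g] by at most [2 ^- (N + J)]. *)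
  move=> m g Kg; apply/ler_addgt0Pr => d d0.
  have d20 : 0 < d / 2 by lra.
  have [J1 hJ1] := sn_cvg_continuous ux (ex_intro _ m Kg) d20.
  have [J2 hJ2] := exists_pow2N_lt d20.
  pose J := maxn J1 (maxn m J2).
  have mJ : (m <= N + J)%N by rewrite (leq_trans _ (leq_addl _ _))// !leq_max leqnn !orbT.
  have J2J : (J2 <= N + J)%N by rewrite (leq_trans _ (leq_addl _ _))// !leq_max leqnn !orbT.
  have := hJ1 J (leq_maxl _ _); rewrite ltr_distl => /andP[+ _].
  have := Isup _ _ _ (polarS _ _ _ mJ Kg) (Iu J).
  have := le_lt_trans (@ler_pow2N R _ _ J2J) hJ2; lra.
(* A near-maximizer of the zero functional shows that [C] is nonempty. *)
have C0 : C !=set0.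
  have K0 : polar (sn 0%N) (fun=> 0).
    split => [a x y|x]; first by rewrite mulr0 addr0.
    by rewrite normr0 seminorm_ge0//; exact: sn_seminorm.
  have [|x Cx _] := adh (fun=> 0) 1 _ ltr01; last by exists x.
  by apply/(fdual_polarP fp); exists 0%N.
have Cphi x f : C x -> fdual p f -> f x <= phi f.
  by move=> Cx /(fdual_polarP fp)[n Kf]; exact: Cx Kf.
exists C; split; last first.
  move=> f df; apply/eqP; rewrite eq_le supportf_le//=; last by move=> x /Cphi; exact.
  apply/ler_addgt0Pr => e e0; have [x Cx fx] := adh f e df e0.
  have : f x <= supportf f C.
    by apply: supportf_ge => //; exists (phi f) => _ [y /Cphi Cy <-]; exact: Cy.
  lra.
split => //; split; last first.
  move=> x y t Cx Cy t0 t1 n f Kf; have lf := Kf.1.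
  rewrite (linear_formD _ _ lf) (linear_formZ t x lf) (linear_formZ (1 - t) y lf).
  have t1' : 0 <= 1 - t by lra.
  have := ler_wpM2l t0 (Cx _ _ Kf); have := ler_wpM2l t1' (Cy _ _ Kf); lra.
apply: (totally_bounded_d_compact fp) => [n e e0|u x Cu ux n f Kf]; last first.
  apply/ler_addgt0Pr => e e0.
  have [N /(_ _ (leqnn N))] := sn_cvg_continuous ux (ex_intro _ n Kf) e0.
  by rewrite ltr_distl => /andP[+ _]; have := Cu N n f Kf; lra.
have e20 : 0 < e / 2 by lra.
have [M hM] := exists_pow2N_lt e20; pose m := maxn n M.
have hm := le_lt_trans (@ler_pow2N R _ _ (leq_maxr n M)) hM.
(* Every point of [C] is within [e / 2] of [I m] by separation, so a finite [e / 2]-net of [I m] is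
   an [e]-net of [C]. *)
have [I0 cI tI hI] := IP m; have [t ht] := tI _ e20; exists t => x Cx.
have [f Kf|y Iy xy] := Idist m m x (e / 2).
  have := Cx _ _ Kf; have := hI _ Kf; rewrite ler_distl => /andP[+ _].
  by move: hm; rewrite -/m; lra.
have [z zt yz] := ht _ Iy; exists z => //.
apply: le_lt_trans (sn_mono fp _ (leq_maxl n M)) _.
have := seminorm_triangle x y z (sn_seminorm fp m); rewrite -/m; lra.
Qed.

End frechet_support.

(** * Functionals close to support functions, and their sums and multiples *)

Section approximable_functionals.
Variables (R : realType) (X : lmodType R) (q : X -> R).
Hypothesis sq : is_seminorm q.
Implicit Types (A B I : set X) (e m : R) (phi : (X -> R) -> R).

Definition approximable e phi := exists I,
  [/\ I !=set0, fconvex I, totally_bounded q I &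
    forall f, polar q f -> `|supportf f I - phi f| <= e].

Lemma approximable_eq (e e' : R) phi phi' : e <= e' ->
  (forall f, polar q f -> phi f = phi' f) -> approximable e phi -> approximable e' phi'.
Proof.
move=> ee' h [I [I0 cI tI hI]]; exists I; split => // f Kf.
by rewrite -h//; exact: le_trans (hI _ Kf) ee'.
Qed.

Lemma approximable_small e phi : (forall f, polar q f -> `|phi f| <= e) ->
  approximable e phi.
Proof.
move=> h; exists [set 0]; split.
- by exists 0.
- by move=> x y t -> -> _ _; rewrite /= !scaler0 addr0.
- move=> d d0; exists [:: 0] => x ->; exists 0; rewrite ?inE//.
  by rewrite subrr seminorm0.
- move=> f Kf; rewrite (@supportf_eq R X f _ 0) ?sub0r ?normrN//; first exact: h.
  + by exists 0.
  + by move=> x ->; rewrite linear_form0//; exact: Kf.1.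
  + by move=> d d0; exists 0 => //; rewrite linear_form0 ?sub0r ?oppr_le0 ?ltW//; exact: Kf.1.
Qed.

(** The Minkowski sum of the two sets works, since its support function is the sum of theirs. *)
Lemma approximableD e1 e2 phi1 phi2 : approximable e1 phi1 -> approximable e2 phi2 ->
  approximable (e1 + e2) (fun f => phi1 f + phi2 f).
Proof.
move=> [A [A0 cA tA hA]] [B [B0 cB tB hB]].
exists [set z | exists x y, [/\ A x, B y & z = x + y]]; split.
- by have [[x Ax] [y By]] := (A0, B0); exists (x + y), x, y.
- move=> _ _ t [x [y [Ax By ->]]] [x' [y' [Ax' By' ->]]] t0 t1.
  exists (t *: x + (1 - t) *: x'), (t *: y + (1 - t) *: y').
  by split; [exact: cA|exact: cB|rewrite !scalerDr addrACA].
- move=> e e0; have e20 : 0 < e / 2 by lra.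
  have [[s hs] [t ht]] := (tA _ e20, tB _ e20).
  exists [seq x + y | x <- s, y <- t] => _ [x [y [/hs[x' sx' xx'] /ht[y' ty' yy'] ->]]].
  exists (x' + y'); first by apply/allpairsP; exists (x', y').
  by rewrite opprD addrACA; have := sq.1 (x - x') (y - y'); lra.
- move=> f Kf; have bA := totally_bounded_has_ubound tA Kf.
  have bB := totally_bounded_has_ubound tB Kf.
  rewrite (@supportf_eq R X f _ (supportf f A + supportf f B)).
  + rewrite opprD addrACA; apply: (le_trans (ler_normD _ _)).
    by apply: lerD; [exact: hA|exact: hB].
  + by have [[x Ax] [y By]] := (A0, B0); exists (x + y), x, y.
  + move=> _ [x [y [Ax By ->]]]; rewrite (linear_formD _ _ Kf.1).
    by apply: lerD; exact: supportf_ge.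
  + move=> e e0; have e20 : 0 < e / 2 by lra.
    have [x Ax fx] := supportf_adherent bA A0 e20.
    have [y By fy] := supportf_adherent bB B0 e20.
    exists (x + y); first by exists x, y.
    by rewrite (linear_formD _ _ Kf.1); lra.
Qed.

Lemma approximableZ e m phi A : 0 <= m -> A !=set0 -> fconvex A -> totally_bounded q A ->
  (forall f, polar q f -> `|phi f - m * supportf f A| <= e) -> approximable e phi.
Proof.
move=> m0 A0 cA tA h; exists [set m *: x | x in A]; split.
- by have [x Ax] := A0; exists (m *: x), x.
- move=> _ _ t [x Ax <-] [y Ay <-] t0 t1; exists (t *: x + (1 - t) *: y); first exact: cA.
  by rewrite scalerDr !scalerA ![m * _]mulrC.
(* The tolerance is divided by [m + 1] because [m] may be 0. *)
- move=> d d0; have m10 : 0 < m + 1 by lra.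
  have [s hs] := tA _ (divr_gt0 d0 m10).
  exists [seq m *: x | x <- s] => _ [x /hs[y sy xy] <-].
  exists (m *: y); first exact: map_f.
  rewrite -scalerBr sq.2 ger0_norm//; move: xy; rewrite ltr_pdivlMr// => xy.
  have := seminorm_ge0 (x - y) sq; nra.
- move=> f Kf; have bA := totally_bounded_has_ubound tA Kf.
  rewrite distrC (@supportf_eq R X f _ (m * supportf f A)); first exact: h.
  + by have [x Ax] := A0; exists (m *: x), x.
  + move=> _ [x Ax <-]; rewrite (linear_formZ _ _ Kf.1) ler_wpM2l//.
    exact: supportf_ge.
  + move=> d d0; have m10 : 0 < m + 1 by lra.
    have [x Ax fx] := supportf_adherent bA A0 (divr_gt0 d0 m10).
    exists (m *: x); first by exists x.
    rewrite (linear_formZ _ _ Kf.1).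
    have -> : d = (d / (m + 1)) * (m + 1) by rewrite divfK// gt_eqF.
    have := divr_gt0 d0 m10; move: fx; set c := d / (m + 1); nra.
Qed.

End approximable_functionals.

(** * From the Hausdorff metric to closeness in one seminorm *)

Lemma fhausdorff_close (R : realType) (X : lmodType R) (p : nat -> X -> R) n (e : R) :
  frechet_seminorms p -> 0 < e -> exists2 d : R, 0 < d & forall A B,
    A !=set0 -> B !=set0 -> fhausdorff p A B < d -> close (sn p n) e A B.
Proof.
move=> fp e0; have [d d0 h] := fdist_small_sn fp n e0; exists d => // A B A0 B0.
have excess C D : C !=set0 -> D !=set0 -> fexcess p C D < d ->
    forall c, C c -> exists2 x, D x & fdist p c x < d.
  move=> C0 [y Dy] Ed c Cc.
  have lb c' : has_lbound [set fdist p c' x | x in D].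
    by exists 0 => _ [x _ <-]; exact: fdist_ge0.
  (* As [fdist] is bounded by 1, the supremum in [fexcess] is over a bounded set and dominates each
     of its elements. *)
  have cd : dist_to p c D < d.
    apply: le_lt_trans Ed; apply: ub_le_sup; last by exists c.
    exists 1 => _ [c' _ <-]; apply: le_trans (fdist_le1 fp c' y).
    by apply: ge_inf => //; exists y.
  have hi : has_inf [set fdist p c x | x in D] by split => //; exists (fdist p c y), y.
  have d'0 : 0 < d - dist_to p c D by lra.
  have [_ [x Dx <-]] := inf_adherent d'0 hi.
  by rewrite -/(dist_to p c D) addrC subrK; exists x.
rewrite /fhausdorff gt_max => /andP[AB BA]; split => [a /(excess _ _ A0 B0 AB)[b Bb ab]|].
  by exists b; rewrite // ltW// h.
move=> b /(excess _ _ B0 A0 BA)[a Aa ab]; exists a => //.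
by rewrite seminormB ?ltW ?h//; exact: sn_seminorm.
Qed.

(** * A Vitali-Hahn-Saks theorem *)

Section equi_absolute_continuity.
Context d (T : measurableType d) (R : realType) (mu : {measure set T -> \bar R}).
Implicit Types (nu : set T -> R) (A B : set T).

Definition ac_charge nu :=
  (forall A B, measurable A -> measurable B -> A `&` B = set0 ->
     nu (A `|` B) = nu A + nu B) /\
  (forall e : R, 0 < e -> exists2 d : R, 0 < d & forall A, measurable A ->
     (mu A < d%:E)%E -> `|nu A| < e).

Lemma ac_chargeB nu1 nu2 : ac_charge nu1 -> ac_charge nu2 ->
  ac_charge (fun A => nu1 A - nu2 A).
Proof.
move=> [a1 c1] [a2 c2]; split => [A B mA mB AB|e e0].
  by rewrite a1// a2// opprD addrACA.
have e20 : 0 < e / 2 by lra.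
have [d1 d10 h1] := c1 _ e20; have [d2 d20 h2] := c2 _ e20.
exists (Num.min d1 d2) => [|A mA Ad]; first by rewrite lt_min d10.
have [Ad1 Ad2] : (mu A < d1%:E)%E /\ (mu A < d2%:E)%E.
  by split; apply: lt_le_trans Ad _; rewrite lee_fin ge_min lexx ?orbT.
by have := ler_normB (nu1 A) (nu2 A); have := h1 _ mA Ad1; have := h2 _ mA Ad2; lra.
Qed.

Lemma ac_chargeID nu A B : ac_charge nu -> measurable A -> measurable B ->
  nu A = nu (A `&` B) + nu (A `\` B).
Proof.
move=> [nuD _] mA mB; rewrite -[in LHS](setUIDK A B) nuD//.
- exact: measurableI.
- exact: measurableD.
- by rewrite setDE setIACA setICr setI0.
Qed.

Lemma ac_charge_diff nu A B : ac_charge nu -> measurable A -> measurable B ->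
  nu A - nu B = nu (A `\` B) - nu (B `\` A).
Proof.
move=> cn mA mB; rewrite (ac_chargeID cn mA mB) (ac_chargeID cn mB mA) setIC; lra.
Qed.

(* Vitali-Hahn-Saks by a gliding hump: the sets [S k] change by ever smaller
   sets [E (n k)] so as to keep [nu (n k) (S k)] away from the limit charge. *)
Lemma equi_absolute_continuity (N : set (set T -> R)) (F : set_system nat) :
  ProperFilter F -> \oo `<=` F ->
  (forall nu, N nu -> ac_charge nu) ->
  (forall nu_ : nat -> set T -> R, (forall n, N (nu_ n)) -> exists2 nu, ac_charge nu &
     forall A, measurable A -> (fun n => nu_ n A) @ F --> nu A) ->
  forall e : R, 0 < e -> exists2 d : R, 0 < d & forall A nu, measurable A ->
    (mu A < d%:E)%E -> N nu -> `|nu A| < e.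
Proof.
move=> FF Foo Nac Ncpt e e0; apply: contrapT => bad.
(* Failure of the conclusion gives sets [E n] of summable measure and charges of size at least [e]
   on them. *)
have /choice[En EnP] : forall n, exists En : set T * (set T -> R),
    [/\ measurable En.1, (mu En.1 < (1 / (2 ^ n.+1)%:R)%:E)%E, N En.2 & e <= `|En.2 En.1| ].
  move=> n; apply: contrapT => h; apply: bad.
  exists (1 / (2 ^ n.+1)%:R); first by rewrite divr_gt0// ltr0n expn_gt0.
  move=> A nu mA Ad Nnu; rewrite ltNge; apply/negP => enu.
  by apply: h; exists (A, nu).
pose E n := (En n).1; pose nu_ n := (En n).2.
have mE n : measurable (E n) by have [] := EnP n.
have Nnu n : N (nu_ n) by have [] := EnP n.
have Ee n : e <= `|nu_ n (E n)| by have [] := EnP n.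
pose tail n := \bigcup_(k in [set k | (n <= k)%N]) E k.
have mtail n : measurable (tail n) by apply: bigcup_measurable.
have Etail n k : (n <= k)%N -> E k `<=` tail n by move=> nk x; exists k.
have tailS m n : (m <= n)%N -> tail n `<=` tail m.
  by move=> mn x [k /= nk]; exists k => //=; exact: leq_trans nk.
have sumE : (\sum_(n <oo) mu (E n) < +oo)%E.
  apply: (@le_lt_trans _ _ (\sum_(n <oo) (0 + (1 / (2 ^ n.+1)%:R)%:E))%E).
    by apply: lee_nneseries => // n _; rewrite add0e ltW//; have [] := EnP n.
  apply: le_lt_trans (@epsilon_trick R (fun=> 0%E) 1 xpredT _ _) _ => //.
  by rewrite eseries0// add0e ltry.
(* By the Borel-Cantelli lemma the upper limit of the [E n] is null, and the measures of the tails
   converge to its measure. *)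
have mutail0 : (mu (tail n) @[n --> \oo] --> 0)%E.
  rewrite -(lim_sup_set_cvg0 mE sumE); apply: lim_sup_set_cvg => //.
  apply: le_lt_trans sumE; apply: measure_sigma_subadditive => //.
    exact: (mtail 0%N).
  by move=> x [k _ Ek]; exists k.
have small nu (c : R) : ac_charge nu -> 0 < c -> exists M, forall A, measurable A ->
    A `<=` tail M -> `|nu A| < c.
  move=> [_ /(_ c) h] /h[dl dl0 hdl].
  have /fine_cvgP[fin /cvgrPdist_lt/(_ dl dl0) near0] := mutail0.
  have [M _ /(_ M (leqnn M))[fM dM]] := filterI fin near0.
  exists M => A mA AM; apply: hdl => //.
  apply: (@le_lt_trans _ _ (mu (tail M))); first by rewrite le_measure ?inE.
  rewrite -(fineK fM) lte_fin; move: dM; rewrite /= sub0r normrN.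
  exact/le_lt_trans/ler_norm.
have [nuoo acoo limoo] := Ncpt nu_ Nnu.
(* [la n] tends to 0 along [F] on every measurable set, yet stays at least [e / 2] in absolute value
   on [E n] for [n >= n0]. *)
pose la n A := nu_ n A - nuoo A.
have acla n : ac_charge (la n) by apply: ac_chargeB => //; exact: Nac.
have e20 : 0 < e / 2 by lra.
have [n0 n0P] := small _ _ acoo e20.
have laE n : (n0 <= n)%N -> e / 2 <= `|la n (E n)|.
  move=> n0n; have := n0P _ (mE n) (Etail _ _ n0n).
  by have := lerB_dist (nu_ n (E n)) (nuoo (E n)); have := Ee n; rewrite /la; lra.
have e320 : 0 < e / 32 by lra.
have /choice[Nf NfP] := fun n => small _ _ (acla n) e320.
have nearla (s : seq (set T)) (c : R) : 0 < c -> (forall B, B \in s -> measurable B) ->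
    \forall k \near F, forall B, B \in s -> `|la k B| < c.
  move=> c0; elim: s => [|B s IH] ms; first exact: filterE.
  have {}IH := IH (fun C Cs => ms C (mem_behead (s := B :: s) Cs)).
  have /cvgrPdist_lt/(_ c c0) limB := limoo _ (ms B (mem_head _ _)).
  apply: filterS (filterI limB IH) => k [kB ks] C; rewrite inE => /predU1P[->|/ks//].
  by rewrite /la distrC.
(* The state is the list of all sets built so far, the latest one at the head, with the last index
   used. The next index makes [la] tiny on the whole list and lies beyond the tail where the
   previous [la] drops below [e / 32]. *)
have step (st : seq (set T) * nat) : exists Sn : set T * nat,
    (n0 <= st.2)%N -> (forall B, B \in st.1 -> measurable B) -> head set0 st.1 \in st.1 ->
    [/\ measurable Sn.1, (maxn st.2.+1 (Nf st.2) <= Sn.2)%N,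
        forall B, B \in st.1 -> `|la Sn.2 B| < 2 ^- size st.1,
        e / 8 <= `|la Sn.2 Sn.1| &
        forall x, ~ E Sn.2 x -> (Sn.1 x <-> head set0 st.1 x)].
  case: st => s n /=; set S := head set0 s.
  have [[n0n ms Ss]|h] := pselect [/\ (n0 <= n)%N, forall B, B \in s -> measurable B & S \in s];
    last by exists (set0, 0%N) => *; exfalso; exact: h.
  pose c := Num.min (2 ^- size s) (e / 16) : R.
  have c0 : 0 < c by rewrite lt_min pow2N_gt0; lra.
  have nearN : \forall k \near F, (maxn n.+1 (Nf n) <= k)%N.
    by apply: Foo; exact: nbhs_infty_ge.
  have [k [kla kN]] := filter_ex (filterI (nearla _ _ c0 ms) nearN).
  have mS := ms _ Ss; have laS : `|la k S| < e / 16.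
    by apply: lt_le_trans (kla _ Ss) _; rewrite ge_min lexx orbT.
  have n0k : (n0 <= k)%N.
    exact: leq_trans n0n (leq_trans (leqnSn n) (leq_trans (leq_maxl _ _) kN)).
  have laB B : B \in s -> `|la k B| < 2 ^- size s.
    by move=> /kla/lt_le_trans; apply; rewrite ge_min lexx.
  have laEk := laE _ n0k; have lak := ac_chargeID (acla k) (mE k) mS.
  (* One of [E k] minus [S] and [E k] meet [S] carries at least [e / 4]. Adding [E k] to [S] or
     removing it gives a set on which [la k] is at least [e / 4 - e / 16], hence at least
     [e / 8]. *)
  have [big|small'] := leP (e / 4) `|la k (E k `\` S)|.
    exists (S `|` E k, k) => _ _ _ /=; split => //; first exact: measurableU.
      have -> : S `|` E k = S `|` (E k `\` S) by rewrite setDE setUIr setUCr setIT.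
      rewrite (acla k).1//; [|exact: measurableD|by rewrite setDE setICA setICr setI0].
      by rewrite addrC; have := lerB_normD (la k (E k `\` S)) (la k S); lra.
    by move=> x nEx; split; [case|left].
  exists (S `\` E k, k) => _ _ _ /=; split => //; first exact: measurableD.
    have := ac_chargeID (acla k) mS (mE k); rewrite setIC => lakS.
    have -> : la k (S `\` E k) = la k S - la k (E k `&` S) by lra.
    have := lerB_dist (la k (E k `&` S)) (la k S); rewrite distrC.
    by have := ler_normD (la k (E k `&` S)) (la k (E k `\` S)); rewrite -lak; lra.
  by move=> x nEx; split; [case|].
have /choice[g gP] := step.
pose st := fix st k := if k is j.+1 then ((g (st j)).1 :: (st j).1, (g (st j)).2)
                       else ([:: set0], n0).
pose S k := head set0 (st k).1; pose n k := (st k).2.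
have inv k : [/\ (n0 <= n k)%N, forall B, B \in (st k).1 -> measurable B,
    S k \in (st k).1 & size (st k).1 = k.+1].
  elim: k => [|k [n0k mk Sk sk]].
    split => //; last by rewrite /S/= mem_head.
    by move=> B; rewrite /= inE => /eqP ->.
  have [mS nk _ _ _] := gP _ n0k mk Sk; split => /=.
  - by apply: leq_trans n0k _; apply: leq_trans (leqnSn _) (leq_trans (leq_maxl _ _) nk).
  - by move=> B; rewrite inE => /predU1P[->//|/mk].
  - by rewrite inE eqxx.
  - by rewrite sk.
have next k : [/\ (maxn (n k).+1 (Nf (n k)) <= n k.+1)%N,
    forall B, B \in (st k).1 -> `|la (n k.+1) B| < 2 ^- k.+1,
    e / 8 <= `|la (n k.+1) (S k.+1)| &
    forall x, ~ E (n k.+1) x -> (S k.+1 x <-> S k x)].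
  by have [n0k mk Sk sk] := inv k; have [_ h1 h2 h3 h4] := gP _ n0k mk Sk; split => //;
     move=> B /h2; rewrite sk.
have mS k : measurable (S k) by have [_ mk Sk _] := inv k; exact: mk.
have hist j k : (j <= k)%N -> S j \in (st k).1.
  elim: k => [|k IH]; first by rewrite leqn0 => /eqP ->; have [] := inv 0%N.
  rewrite leq_eqVlt => /predU1P[->|jk]; first by have [] := inv k.+1.
  by rewrite /= inE IH ?orbT.
have nS k : (n k < n k.+1)%N by have [h _ _ _] := next k; exact: leq_trans (leq_maxl _ _) h.
have n_mono j k : (j <= k)%N -> (n j <= n k)%N.
  elim: k => [|k IH]; first by rewrite leqn0 => /eqP ->.
  by rewrite leq_eqVlt => /predU1P[->//|/IH h]; exact: leq_trans h (ltnW (nS k)).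
have n_ge k : (k <= n k)%N by elim: k => [//|k IH]; exact: leq_ltn_trans IH (nS k).
have agree k l x : (k <= l)%N -> ~ tail (n k.+1) x -> S l x <-> S k x.
  elim: l => [|l IH]; first by rewrite leqn0 => /eqP ->.
  rewrite leq_eqVlt => /predU1P[->//|kl nx].
  have [_ _ _ /(_ x)] := next l; rewrite (IH kl nx); apply.
  by move=> Ex; apply: nx; exact: Etail (n_mono _ _ (kl : (k.+1 <= l.+1)%N)) _ Ex.
(* Outside [tail (n k.+1)] the sets no longer change after stage [k], so [Soo] differs from [S k]
   only inside that tail. *)
pose Soo := lim_sup_set S.
have mSoo : measurable Soo.
  by apply: bigcap_measurable => // k _; apply: bigcup_measurable.
have agreeoo k x : ~ tail (n k.+1) x -> Soo x <-> S k x.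
  move=> nx; split => [/(_ k I)[l /= kl] /(agree _ _ _ kl nx)//|Sx m _].
  exists (maxn k m); first by rewrite /= leq_maxr.
  by apply/(agree _ _ _ (leq_maxl k m) nx).
have diff nu (c : R) M k : ac_charge nu ->
    (forall A, measurable A -> A `<=` tail M -> `|nu A| < c) -> (M <= n k.+1)%N ->
    `|nu Soo - nu (S k)| < 2 * c.
  move=> acn nuc Mk; rewrite (ac_charge_diff acn)//.
  have sub1 : Soo `\` S k `<=` tail M.
    move=> x [Sx nSx]; apply: (tailS _ _ Mk); apply: contrapT => nx; apply: nSx.
    by apply/(agreeoo _ _ nx).
  have sub2 : S k `\` Soo `<=` tail M.
    move=> x [Sx nSx]; apply: (tailS _ _ Mk); apply: contrapT => nx; apply: nSx.
    by apply/(agreeoo _ _ nx).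
  have := nuc _ (measurableD mSoo (mS k)) sub1.
  have := nuc _ (measurableD (mS k) mSoo) sub2.
  by have := ler_normB (nu (Soo `\` S k)) (nu (S k `\` Soo)); lra.
(* Compactness is used a second time, for the subsequence, whose limit along [F] may differ from
   [nuoo]. The two limits agree on each [S j], where [la (n k)] tends to 0 in the ordinary sense,
   and therefore on [Soo] by absolute continuity. *)
have [nu' ac' lim'] := Ncpt (fun k => nu_ (n k)) (fun k => Nnu (n k)).
have eqS j : nu' (S j) = nuoo (S j).
  have h : (fun k => nu_ (n k) (S j)) @ F --> nuoo (S j).
    apply: cvg_trans (_ : _ @ \oo --> nuoo (S j)); first exact: cvg_app.
    apply/cvgrPdist_lt => c c0.
    have [M hM] := exists_pow2N_lt c0.
    exists (maxn j M).+1 => // -[//|k] /=; rewrite ltnS geq_max => /andP[jk Mk].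
    have [_ /(_ _ (hist _ _ jk)) + _ _] := next k; rewrite distrC => /lt_trans; apply.
    by apply: le_lt_trans hM; apply: ler_pow2N; exact: leq_trans Mk (leqnSn k).
  exact: (cvg_unique (@norm_hausdorff _ _) (lim' _ (mS j)) h).
have eqSoo : nu' Soo = nuoo Soo.
  apply/eqP; rewrite -subr_eq0 -normr_le0; apply/ler_addgt0Pr => c c0; rewrite add0r.
  have c20 : 0 < c / 2 by lra.
  have ac2 := ac_chargeB ac' acoo; have [M hM] := small _ _ ac2 c20.
  have := diff _ _ _ M ac2 hM (leq_trans (n_ge M) (ltnW (nS M))).
  by rewrite eqS subrr subr0; lra.
(* Replacing [S k.+1] by [Soo] costs less than [2 * (e / 32)] out of [e / 8]. This keeps the
   subsequence away from [nuoo Soo], its own limit. *)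
have far k : e / 16 <= `|la (n k.+1) Soo|.
  have [_ _ big _] := next k.
  have [kN _ _ _] := next k.+1.
  have := diff _ _ _ k.+1 (acla (n k.+1)) (NfP (n k.+1)) (leq_trans (leq_maxr _ _) kN).
  have := lerB_dist (la (n k.+1) (S k.+1)) (la (n k.+1) Soo); rewrite distrC; lra.
have e160 : 0 < e / 16 by lra.
have /cvgrPdist_lt/(_ _ e160) near' := lim' _ mSoo.
have near1 : \forall k \near F, (1 <= k)%N by apply: Foo; exact: nbhs_infty_ge.
have [[|k] [//= + _]] := filter_ex (filterI near' near1).
by rewrite eqSoo distrC; have := far k; rewrite /la; lra.
Qed.

End equi_absolute_continuity.

(** * Indefinite integrals and their absolute continuity *)

Section integrals_of_integrable_functions.
Context d (T : measurableType d) (R : realType) (mu : {measure set T -> \bar R}).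
Variable D : set T.
Hypothesis mD : measurable D.
Implicit Types (A B : set T) (g : T -> R).

Lemma Rintegral_setID A B g : measurable A -> measurable B ->
  mu.-integrable A (EFin \o g) ->
  \int[mu]_(x in A) g x = \int[mu]_(x in A `&` B) g x + \int[mu]_(x in A `\` B) g x.
Proof.
move=> mA mB ig; rewrite -[in LHS](setUIDK A B) Rintegral_setU ?setUIDK//.
- exact: measurableI.
- exact: measurableD.
- by apply/disj_setPS => x [[]] _ Bx [].
Qed.

Lemma integrable_ac_charge g : mu.-integrable D (EFin \o g) ->
  ac_charge mu (fun A => \int[mu]_(x in A `&` D) g x).
Proof.
move=> ig; split => [A B mA mB AB|e e0].
  rewrite setIUl Rintegral_setU//; try exact: measurableI.
    apply: integrableS ig => //.
      by rewrite -setIUl; apply: measurableI => //; exact: measurableU.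
    by move=> x [[]|[]].
  by apply/disj_setPS => x [[Ax _] [Bx _]]; rewrite -AB; split.
have ig' : mu.-integrable setT (EFin \o (g \_ D)).
  by move: ig => /(integrable_mkcond _ mD); rewrite restrict_EFin.
have [r [r0 re]] := integral_normr_continuous ig' e0.
exists r => // A mA /(re _ mA); apply: le_lt_trans.
rewrite Rintegral_mkcondr; apply: le_normr_Rintegral => //.
by apply: integrableS ig'.
Qed.

(** Split [A] according to the sign of [g]. Both halves have measure below [dl], so each contributes
    less than [e / 2] to the integral of the absolute value. *)
Lemma equi_ac_normr (G : set (T -> R)) : (forall g, G g -> mu.-integrable D (EFin \o g)) ->
  (forall e : R, 0 < e -> exists2 dl : R, 0 < dl & forall A g, measurable A ->
    (mu A < dl%:E)%E -> G g -> `|\int[mu]_(x in A `&` D) g x| < e) ->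
  forall e : R, 0 < e -> exists2 dl : R, 0 < dl & forall A g, measurable A -> A `<=` D ->
    (mu A < dl%:E)%E -> G g -> (\int[mu]_(x in A) `|g x|%:E < e%:E)%E.
Proof.
move=> iG h e e0; have e20 : 0 < e / 2 by lra.
have [dl dl0 hdl] := h _ e20; exists dl => // A g mA AD Adl Gg.
have ig := iG _ Gg; have mg : measurable_fun D g.
  by apply/measurable_EFinP; exact: measurable_int ig.
pose P := D `&` g @^-1` `[0, +oo[%classic.
have mP : measurable P by exact: mg.
have igA : mu.-integrable A (EFin \o g) by exact: integrableS ig.
have inA : mu.-integrable A (EFin \o (@Num.norm _ R \o g)) by exact: integrable_norm.
have -> : (\int[mu]_(x in A) `|g x|%:E = (\int[mu]_(x in A) `|g x|)%:E)%E.
  by rewrite /Rintegral fineK//; exact: integrable_fin_num inA.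
rewrite lte_fin (Rintegral_setID mA mP inA).
have mAP : measurable (A `&` P) by exact: measurableI.
have mAnP : measurable (A `\` P) by exact: measurableD.
have -> : \int[mu]_(x in A `&` P) `|g x| = \int[mu]_(x in A `&` P) g x.
  apply: eq_Rintegral => x; rewrite inE => -[_ [_]].
  by rewrite /= in_itv/= andbT => /ger0_norm.
have -> : \int[mu]_(x in A `\` P) `|g x| = - \int[mu]_(x in A `\` P) g x.
  rewrite -mulN1r -RintegralZl//; last exact: integrableS igA.
  apply: eq_Rintegral => x; rewrite inE => -[Ax nP].
  rewrite mulN1r ler0_norm//; rewrite leNgt; apply/negP => /ltW gx; apply: nP.
  by split; [exact: AD|rewrite /= in_itv/= gx].
have sub B : measurable B -> B `<=` A -> `|\int[mu]_(x in B) g x| < e / 2.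
  move=> mB BA; have BD : B = B `&` D by rewrite (setIidl _)//; exact: subset_trans AD.
  rewrite BD; apply: hdl => //; apply: le_lt_trans Adl.
  by rewrite le_measure ?inE.
have := sub _ mAP (@subIsetl _ _ _); have := sub _ mAnP (@subDsetl _ _ _).
by rewrite !ltr_norml; lra.
Qed.

(** With a cover of [D] by finitely many small sets this turns equi-absolute continuity into a bound
    in the first mean, uniform over a family. *)
Lemma integral_normr_cover (g : T -> R) (e : R) (P : nat -> set T) n : 0 <= e ->
  measurable_fun D g -> (forall k, measurable (P k)) ->
  (forall k, \int[mu]_(x in P k `&` D) `|g x|%:E <= e%:E)%E ->
  (\int[mu]_(x in \big[setU/set0]_(k < n) (P k `&` D)) `|g x|%:E <= (n%:R * e)%:E)%E.
Proof.
move=> e0 mg mP Pe; elim: n => [|n IH]; first by rewrite big_ord0 integral_set0 mul0r.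
pose U := \big[setU/set0]_(k < n) (P k `&` D).
have mPD k : measurable (P k `&` D) by exact: measurableI.
have mU : measurable U by apply: bigsetU_measurable.
have UD : U `<=` D.
  apply: (big_ind (fun A => A `<=` D)) => [//|A B AD BD x [/AD|/BD]//|k _ x []//].
have mng : measurable_fun D (fun x => `|g x|%:E).
  by apply/measurable_EFinP; exact: measurableT_comp.
rewrite big_ord_recr/= -/U.
have -> : U `|` (P n `&` D) = U `|` ((P n `&` D) `\` U).
  by rewrite setDE [RHS]setUIr setUCr setIT.
rewrite ge0_integral_setU//; first last.
- by apply/disj_setPS => x [Ux [_]].
- by apply: measurable_funS mng => // x [/UD|[[]]].
- exact: measurableD.
rewrite -natr1 mulrDl mul1r EFinD leeD//.
apply: le_trans (Pe n); apply: ge0_subset_integral => //; try exact: measurableD.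
by apply: measurable_funS mng => // x [].
Qed.

End integrals_of_integrable_functions.

(** * Lebesgue measure on the unit interval *)

Section unit_interval.
Variable R : realType.
Notation mu := (@completed_lebesgue_measure R).

Lemma lebT_ocitv (a b : R) : a <= b ->
  @measurable _ (lebT R) `]a, b]%classic /\ mu (`]a, b]%classic : set (lebT R)) = (b - a)%:E.
Proof.
move=> ab; split.
  apply: sub_caratheodory; apply: sub_sigma_algebra; exact: is_ocitv.
have h := @measurable_mu_extE _ R (ocitv_type R) (wlength idfun) _ (is_ocitv a b).
by apply: (etrans h); exact: (@wlength_itv_bnd R idfun a b false false ab).
Qed.

Lemma measurable_I01 : @measurable _ (lebT R) (@I01 R).
Proof. by apply: sub_caratheodory; exact: measurable_itv. Qed.

Lemma mu_I01_lty : (mu (@I01 R) < +oo)%E.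
Proof.
have [m1 mu1] := @lebT_ocitv (-1) 1 ltac:(lra).
apply: (@le_lt_trans _ _ (mu (`]-1, 1]%classic : set (lebT R)))); last by rewrite mu1 ltry.
rewrite le_measure ?inE//; first exact: measurable_I01.
move=> x; rewrite /I01 /= !in_itv/= => /andP[x0 ->].
by rewrite andbT (lt_le_trans _ x0)// ltrN10.
Qed.

Lemma I01_small_cover (h : R) : 0 < h -> exists n (P : nat -> set (lebT R)),
  [/\ forall k, measurable (P k), forall k, (mu (P k) <= h%:E)%E &
    @I01 R `<=` \big[setU/set0]_(k < n) P k].
Proof.
move=> h0; pose P k : set (lebT R) := `](k%:R - 1) * h, k%:R * h]%classic.
have PP k : measurable (P k) /\ (mu (P k) = h%:E)%E.
  have [|m1 ->] := @lebT_ocitv ((k%:R - 1) * h) (k%:R * h); first nra.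
  by split => //; congr EFin; ring.
have cover n (x : R) : 0 <= x -> x <= n%:R * h -> exists2 k, (k <= n)%N & P k x.
  elim: n => [|n IH] x0 xn.
    by exists 0%N; rewrite // /P/= in_itv/= xn andbT; lra.
  have [/(IH x0)[k kn Pk]|nx] := leP x (n%:R * h).
    by exists k => //; exact: leqW.
  exists n.+1 => //; rewrite /P/= in_itv/= xn andbT.
  by rewrite -natr1 addrK.
(* The count is [n.+1] because the half-open interval [P 0] is there to catch the point 0. *)
pose n := Num.bound (h^-1); exists n.+1, P; split => [k|k|x].
- by case: (PP k).
- by case: (PP k) => _ ->.
rewrite /I01/= in_itv/= => /andP[x0 x1].
have h'0 : 0 <= h^-1 by rewrite invr_ge0 ltW.
have nh : 1 <= n%:R * h.
  by rewrite -ler_pdivrMr// mul1r ltW//; exact: archi_boundP.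
have [k kn Px] := cover n x x0 (le_trans x1 nh).
by rewrite -bigcup_mkord; exists k.
Qed.

End unit_interval.

(** * Values and pieces of simple multifunctions *)

Section simple_multifunctions.
Variables (R : realType) (X : lmodType R) (k : nat).
Variables (A : 'I_k -> set (lebT R)) (C : 'I_k -> set X).
Hypothesis dA : forall i j, i != j -> A i `&` A j = set0.

Let U := \big[setU/set0]_(j < k) A j.

Let UP t : U t <-> exists j, A j t.
Proof.
rewrite /U -bigcup_seq; split => [[j _ Aj]|[j Aj]]; first by exists j.
by exists j => //=; rewrite mem_index_enum.
Qed.

Lemma simple_mf_in j t : A j t -> simple_mf A C t = C j.
Proof.
move=> Aj; apply/seteqP; split => x; last by left; exists j.
case=> [[i [Ai]]|[/(_ j)//]].
have [->//|ij] := eqVneq i j.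
by have := dA ij; rewrite -subset0 => /(_ t (conj Ai Aj)).
Qed.

Lemma simple_mf_out t : ~ U t -> simple_mf A C t = [set 0].
Proof.
rewrite UP => nU; apply/seteqP; split => x.
  by case=> [[i [Ai _]]|[_ ->//]]; exfalso; apply: nU; exists i.
by right; split => // j Aj; apply: nU; exists j.
Qed.

Lemma simple_mf_nonempty t : (forall j, C j !=set0) -> simple_mf A C t !=set0.
Proof.
move=> C0; have [/UP[j Aj]|nU] := pselect (U t); first by rewrite (simple_mf_in Aj).
by rewrite simple_mf_out//; exists 0.
Qed.

Hypothesis mA : forall j, measurable (A j).

(* [None] stands for the part off all the [A j], where the multifunction is [{0}]. *)
Definition simple_piece (o : option 'I_k) : set (lebT R) :=
  if o is Some j then A j else ~` \big[setU/set0]_(j < k) A j.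

Lemma simple_piece_measurable o : measurable (simple_piece o).
Proof.
by case: o => [j|] //=; apply: measurableC; apply: bigsetU_measurable.
Qed.

Lemma simple_piece_cover t : exists o, simple_piece o t.
Proof.
by have [/UP[j Aj]|nU] := pselect (U t); [exists (Some j)|exists None].
Qed.

Lemma simple_piece_disjoint o o' : o != o' -> simple_piece o `&` simple_piece o' = set0.
Proof.
have UA j : A j `&` ~` U = set0.
  by rewrite -subset0 => t [Aj]; apply; apply/UP; exists j.
case: o o' => [i|] [j|] //= ij; last by rewrite setIC.
by apply: dA; apply: contra ij => /eqP ->.
Qed.

Lemma simple_piece_constant o s t : simple_piece o s -> simple_piece o t ->
  simple_mf A C s = simple_mf A C t.
Proof.
case: o => [j|] /= Ps Pt; first by rewrite (simple_mf_in Ps) (simple_mf_in Pt).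
by rewrite (simple_mf_out Ps) (simple_mf_out Pt).
Qed.

(** The multifunction takes finitely many values on measurable pieces. Letting [Q] depend on the
    point as well allows a nested use, for relations between two simple multifunctions. *)
Lemma simple_mf_measurable (Q : set X -> set (lebT R)) :
  (forall B, measurable (Q B)) -> measurable [set t | Q (simple_mf A C t) t].
Proof.
move=> mQ; have -> : [set t | Q (simple_mf A C t) t] =
    \big[setU/set0]_(j < k) (A j `&` Q (C j)) `|` (~` U `&` Q [set 0]).
  apply/seteqP; split => t /=.
    have [/UP[j Aj]|nU] := pselect (U t).
      rewrite (simple_mf_in Aj) => Qt; left; rewrite -bigcup_seq.
      by exists j => //=; rewrite mem_index_enum.
    by rewrite simple_mf_out//; right.
  rewrite -bigcup_seq => -[[j _ [Aj Qt]]|[nU Qt]].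
    by rewrite (simple_mf_in Aj).
  by rewrite simple_mf_out.
apply: measurableU; first by apply: bigsetU_measurable => j _; exact: measurableI.
by apply: measurableI => //; apply: measurableC; apply: bigsetU_measurable.
Qed.

End simple_multifunctions.

Lemma measurable_constant d (T : measurableType d) (P : Prop) : measurable [set _ : T | P].
Proof.
have [HP|nP] := pselect P.
  by rewrite (_ : [set _ | P] = setT)//; apply/seteqP; split.
by rewrite (_ : [set _ | P] = set0)//; apply/seteqP; split.
Qed.

(** * Partition into pieces of small oscillation *)

Section bochner_partition.
Variables (R : realType) (X : lmodType R) (p : nat -> X -> R) (G : lebT R -> set X).
Hypothesis fp : frechet_seminorms p.
Notation mu := (@completed_lebesgue_measure R).

(** An Egorov argument: outside a set of small measure one simple multifunction [S N] is within
    [e / 2] of [G], and the pieces of [S N] form the partition. *)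
Lemma bochner_partition n (e d : R) :
  (forall t, @I01 R t -> G t !=set0) -> bochner_measurable p G -> 0 < e -> 0 < d ->
  exists (I : finType) (B : I -> set (lebT R)),
  [/\ forall i, measurable (B i) /\ B i `<=` @I01 R,
    forall i j, i != j -> B i `&` B j = set0,
    (mu (@I01 R `\` \big[setU/set0]_(i : I) B i) < d%:E)%E &
    forall i s t, B i s -> B i t -> close (sn p n) e (G s) (G t)].
Proof.
move=> G0 [k [A [C [mA dA cC]]]] [Z [mZ muZ ZP]] e0 d0.
have e40 : 0 < e / 4 by lra.
have e80 : 0 < e / 8 by lra.
have sq := sn_seminorm fp n.
pose S m t := simple_mf (A m) (C m) t.
have mAj m j : measurable (A m j) := (mA m j).1.
have S0 m t : S m t !=set0.
  by apply: simple_mf_nonempty => [|j]; [exact: dA|case: (cC m j)].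
have closeS t (c : R) : @I01 R t -> ~ Z t -> 0 < c ->
    exists M, forall m, (M <= m)%N -> close (sn p n) c (S m t) (G t).
  move=> It nZ /(fhausdorff_close n fp)[r r0 hr].
  have : (fun m => fhausdorff p (S m t) (G t)) @ \oo --> 0.
    by apply: contrapT => nt; apply: nZ; apply: ZP => /(_ It).
  move=> /cvgrPdist_lt/(_ r r0)[M _ hM]; exists M => m Mm; apply: hr => //; first exact: G0.
  by have := hM _ Mm; rewrite /= sub0r normrN; exact/le_lt_trans/ler_norm.
(* The approximants are compared with one another and not with [G], which makes [D N] visibly
   measurable. *)
pose D N := [set t : lebT R | forall m m', (N <= m)%N -> (N <= m')%N ->
  close (sn p n) (e / 4) (S m t) (S m' t)].
have mD N : measurable (D N).
  have -> : D N = \bigcap_(m in [set m | (N <= m)%N]) \bigcap_(m' in [set m' | (N <= m')%N])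
      [set t | close (sn p n) (e / 4) (S m t) (S m' t)].
    by apply/seteqP; split => t h m; [move=> Nm m' Nm'; exact: h|move=> m' Nm Nm'; exact: h].
  apply: bigcap_measurable => [|m _]; first by exists N => /=.
  apply: bigcap_measurable => [|m' _]; first by exists N => /=.
  apply: (simple_mf_measurable (C m) (dA m) (mAj m)
    (Q := fun B => [set t | close (sn p n) (e / 4) B (S m' t)])) => B.
  apply: (simple_mf_measurable (C m') (dA m') (mAj m')
    (Q := fun B' => [set t | close (sn p n) (e / 4) B B'])) => B'.
  exact: measurable_constant.
pose W N := @I01 R `\` (D N `\` Z).
have mW N : measurable (W N).
  by apply: measurableD; [exact: measurable_I01|exact: measurableD].
(* The [W N] decrease, and their intersection lies in the null set [Z] because convergent
   approximants are eventually close to one another. Continuity from above applies on the finite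
   measure space. *)
have [N hN] : exists N, (mu (W N) < d%:E)%E.
  have capW : \bigcap_N W N `<=` Z.
    move=> t Wt; apply: contrapT => nZ; have [It _] := Wt 0%N I.
    have [M hM] := closeS t _ It nZ e80; have [_] := Wt M I; apply.
    split => // m m' /hM cm /hM cm'.
    have -> : e / 4 = e / 8 + e / 8 by lra.
    exact: close_trans sq cm (closeC sq cm').
  have mcap : measurable (\bigcap_N W N) by apply: bigcapT_measurable.
  have mucap : mu (\bigcap_N W N) = 0%E.
    apply/eqP; rewrite eq_le measure_ge0 andbT -muZ.
    by rewrite le_measure ?inE.
  have : (mu \o W) x @[x --> \oo] --> mu (\bigcap_N W N).
    apply: nonincreasing_cvg_mu => //.
      apply: le_lt_trans (mu_I01_lty R); rewrite le_measure ?inE//; first exact: measurable_I01.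
      exact: subDsetl.
    move=> i j ij; apply/subsetPset; apply: setDS; apply: setSD => t h m m' jm jm'.
    by apply: h; exact: leq_trans ij _.
  rewrite mucap => /fine_cvgP[fin /cvgrPdist_lt/(_ d d0) near0].
  have [M _ /(_ M (leqnn M))[fM dM]] := filterI fin near0.
  have fM' : mu (W M) \is a fin_num by exact: fM.
  exists M; rewrite -(fineK fM') lte_fin; move: dM; rewrite /= sub0r normrN.
  exact/le_lt_trans/ler_norm.
exists (option 'I_(k N)), (fun o => @I01 R `&` (D N `\` Z) `&` simple_piece (A N) o); split.
- move=> o; split; last by move=> t [[]].
  apply: measurableI; last exact: simple_piece_measurable.
  by apply: measurableI; [exact: measurable_I01|exact: measurableD].
- by move=> i j ij; rewrite setIACA (simple_piece_disjoint (dA N) ij) setI0.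
- apply: le_lt_trans hN; rewrite le_measure ?inE//.
    apply: measurableD; first exact: measurable_I01.
    apply: bigsetU_measurable => o _; apply: measurableI; last exact: simple_piece_measurable.
    by apply: measurableI; [exact: measurable_I01|exact: measurableD].
  move=> t [It nB]; split => // Dt; apply: nB.
  have [i iP] := simple_piece_cover (A N) t; rewrite -bigcup_seq.
  by exists i => //=; rewrite mem_index_enum.
move=> o s t [[Is [Ds nZs]] Ps] [[It [Dt nZt]] Pt].
have [Ms hMs] := closeS s _ Is nZs e40; have [Mt hMt] := closeS t _ It nZt e40.
have step u M : D N u -> (forall m, (M <= m)%N -> close (sn p n) (e / 4) (S m u) (G u)) ->
    close (sn p n) (e / 4 + e / 4) (S N u) (G u).
  move=> Du hM; apply: (close_trans sq (Du N (maxn N M) _ _)) => //; first exact: leq_maxl.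
  by apply: hM; exact: leq_maxr.
(* The passage goes from [G s] to [S N s], which equals [S N t], and on to [G t]; each side goes
   through a later approximant and costs twice [e / 4]. *)
have -> : e = (e / 4 + e / 4) + (e / 4 + e / 4) by lra.
apply: (close_trans sq (closeC sq (step s Ms Ds hMs))).
rewrite /S (simple_piece_constant (C N) (dA N) Ps Pt); exact: step Dt hMt.
Qed.

End bochner_partition.

(** * The two implications *)

Section pettis.
Variables (R : realType) (X : lmodType R) (p : nat -> X -> R) (G : lebT R -> set X).
Hypothesis fp : frechet_seminorms p.
Notation mu := (@completed_lebesgue_measure R).

(** The charges are the indefinite integrals of the support functions over one polar, and
    ultralimits of functionals supply the compactness that [equi_absolute_continuity] asks for. *)
Lemma pettis_uniformly_integrable K : pettis_integrable_ck p G -> equicont_dual p K ->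
  uniformly_integrable [set (fun t => supportf f (G t)) | f in K].
Proof.
move=> [iG PG] /(equicont_sub_polar fp)[n Kn].
have mI := @measurable_I01 R.
pose Gs := [set (fun t => supportf f (G t)) | f in polar (sn p n)].
have iGs g : Gs g -> mu.-integrable (@I01 R) (EFin \o g).
  by move=> [f Kf <-]; apply: iG; apply/(fdual_polarP fp); exists n.
have [F [UF Foo]] := @ultraFilterLemma nat \oo _.
have eqac (e : R) : 0 < e -> exists2 dl : R, 0 < dl & forall A g, measurable A ->
    (mu A < dl%:E)%E -> Gs g -> `|\int[mu]_(x in A `&` @I01 R) g x| < e.
  move=> e0.
  pose N := [set (fun A => \int[mu]_(x in A `&` @I01 R) g x) | g in Gs].
  have [||dl dl0 h] := @equi_absolute_continuity _ _ R mu N F _ Foo _ _ e e0.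
  - by move=> _ [g Gg <-]; apply: integrable_ac_charge => //; exact: iGs.
  - move=> nu_ Nnu.
    have /choice[f_ f_P] : forall k, exists f, polar (sn p n) f /\
        nu_ k = (fun A => \int[mu]_(x in A `&` @I01 R) supportf f (G x)).
      by move=> k; have [_ [f Kf <-] <-] := Nnu k; exists f.
    have Kf_ k := (f_P k).1.
    have [f Kf lim] := ultralimit_polar UF (sn_seminorm fp n) Kf_.
    have If : mu.-integrable (@I01 R) (EFin \o (fun t => supportf f (G t))).
      by apply: iGs; exists f.
    exists (fun A => \int[mu]_(x in A `&` @I01 R) supportf f (G x)).
      exact: integrable_ac_charge.
    move=> A mA; have mAI := measurableI _ _ mA mI.
    have [xE [[xE0 [cxE _]] xEP]] := PG _ mAI (@subIsetr _ _ _).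
    (* A single compact [xE] represents the integrals for all functionals of the polar at once, so
       the convergence of support functions on [xE] applies. *)
    have val g : polar (sn p n) g ->
        \int[mu]_(x in A `&` @I01 R) supportf g (G x) = supportf g xE.
      by move=> Kg; rewrite /Rintegral -xEP//; apply/(fdual_polarP fp); exists n.
    rewrite val// (_ : (fun k => nu_ k A) = (fun k => supportf (f_ k) xE)).
      by apply: lim => //; exact: d_compact_totally_bounded.
    by apply/funext => k; rewrite (f_P k).2 val.
  exists dl => // A g mA Ad Gg.
  by apply: (h A (fun A => \int[mu]_(x in A `&` @I01 R) g x)) => //; exists g.
have abs := equi_ac_normr mI iGs eqac.
have sub g : [set (fun t => supportf f (G t)) | f in K] g -> Gs g.
  by move=> [f /Kn Kf <-]; exists f.
split.
- by move=> g /sub/iGs.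
(* The uniform bound: [[0, 1]] is covered by [m] sets of measure below [dl], each contributing at
   most 1. *)
- have [dl dl0 hdl] := abs 1 ltr01.
  have dl20 : 0 < dl / 2 by lra.
  have [m [P [mP muP IP]]] := I01_small_cover dl20.
  exists (m%:R * 1) => g /sub Gg.
  have mg : measurable_fun (@I01 R) g.
    by apply/measurable_EFinP; exact: measurable_int (iGs _ Gg).
  have IE : @I01 R = \big[setU/set0]_(k < m) (P k `&` @I01 R).
    by rewrite -big_distrl/= (setIidr IP).
  rewrite [X in (\int[mu]_(t in X) _)%E]IE.
  apply: (integral_normr_cover mI) => // k.
  apply: ltW; apply: hdl => //; first exact: measurableI.
  apply: (@le_lt_trans _ _ (mu (P k))).
    by rewrite le_measure ?inE//; exact: measurableI.
  by apply: le_lt_trans (muP k) _; rewrite lte_fin; lra.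
- move=> e /abs[dl dl0 h]; exists dl => // A mA AI Ad g /sub; exact: h.
Qed.

(** For any [t0] in [B] the integrand stays within [e] of its value at [t0], so the integral is
    within [e] times the measure of [B] of the support function of a multiple of [G t0]. *)
Lemma approximable_piece n (e : R) (B : set (lebT R)) :
  (forall t, @I01 R t -> ck p (G t)) -> 0 <= e -> measurable B -> B `<=` @I01 R ->
  (forall f, polar (sn p n) f -> mu.-integrable (@I01 R) (EFin \o (fun t => supportf f (G t)))) ->
  (forall s t, B s -> B t -> close (sn p n) e (G s) (G t)) ->
  approximable (sn p n) (e * fine (mu B)) (fun f => \int[mu]_(t in B) supportf f (G t)).
Proof.
move=> cG e0 mB BI iG cB; have sq := sn_seminorm fp n.
have [[t0 Bt0]|/set0P/negP/negPn/eqP ->] := pselect (B !=set0); last first.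
  apply: approximable_small => // f Kf.
  by rewrite Rintegral_set0 measure0 normr0 mulr0.
have [Gt0 [kGt0 cGt0]] := cG _ (BI _ Bt0).
have tGt0 := d_compact_totally_bounded fp n kGt0.
apply: (approximableZ sq (m := fine (mu B)) _ Gt0 cGt0 tGt0); first exact: fine_ge0.
move=> f Kf; pose c := supportf f (G t0).
have bnd t : B t -> c - e <= supportf f (G t) <= c + e.
  move=> Bt; rewrite -ler_distl; apply: close_supportf (cB _ _ Bt Bt0) _ _ => //.
  exact: totally_bounded_has_ubound tGt0 Kf.
have iB : mu.-integrable B (EFin \o (fun t => supportf f (G t))).
  by apply: integrableS (iG _ Kf) => //; exact: measurable_I01.
have muB : (mu B < +oo)%E.
  by apply: le_lt_trans (mu_I01_lty R); rewrite le_measure ?inE//; exact: measurable_I01.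
have icst (r : R) : mu.-integrable B (EFin \o (fun=> r)).
  apply: measurable_bounded_integrable => //.
  by exists `|r|; split => // x xr t _ /=; exact: ltW.
rewrite ler_distl; apply/andP; split.
  have -> : fine (mu B) * c - e * fine (mu B) = (c - e) * fine (mu B) by ring.
  rewrite -Rintegral_cst//; apply: le_Rintegral => // t /bnd/andP[]//.
have -> : fine (mu B) * c + e * fine (mu B) = (c + e) * fine (mu B) by ring.
by rewrite -Rintegral_cst//; apply: le_Rintegral => // t /bnd/andP[].
Qed.

(** By [ck_of_approximable_support] it suffices to approximate the integral over [E] for each [n]
    and [e]: half of [e] pays for the oscillation on the pieces, the other half for the exceptional
    set. *)
Lemma uniformly_integrable_pettis :
  (forall t, @I01 R t -> ck p (G t)) -> bochner_measurable p G ->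
  (forall K, equicont_dual p K ->
     uniformly_integrable [set (fun t => supportf f (G t)) | f in K]) ->
  pettis_integrable_ck p G.
Proof.
move=> cG bG uG; have mI := @measurable_I01 R.
have iG n f : polar (sn p n) f -> mu.-integrable (@I01 R) (EFin \o (fun t => supportf f (G t))).
  by move=> Kf; have [h _ _] := uG _ (polar_equicont fp n); apply: h; exists f.
have iG' f : fdual p f -> mu.-integrable (@I01 R) (fun t => (supportf f (G t))%:E).
  by move=> /(fdual_polarP fp)[n] /iG.
split=> // E mE EI.
suff [C [ckC hC]] : exists C, ck p C /\ forall f, fdual p f ->
    supportf f C = \int[mu]_(t in E) supportf f (G t).
  exists C; split => // f df; rewrite hC// /Rintegral fineK//.
  by exact: (integrable_fin_num mE (integrableS mI mE EI (iG' f df))).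
apply: ck_of_approximable_support => // n e e0.
have sq := sn_seminorm fp n.
have [_ _ ac] := uG _ (polar_equicont fp n).
have e20 : 0 < e / 2 by lra.
have [d d0 hd] := ac _ e20.
(* Oscillation [e'] costs at most [e' * c] in total, which is at most [e / 2]; the added 1 keeps the
   denominator positive. *)
pose c := fine (mu (@I01 R)).
have c0 : 0 <= c by exact: fine_ge0.
have e'0 : 0 < e / 2 / (c + 1) by rewrite divr_gt0//; lra.
set e' := e / 2 / (c + 1) in e'0.
have [I [B [mB dB muB cB]]] := bochner_partition fp n (fun t It => (cG t It).1) bG e'0 d0.
have mBi i : measurable (E `&` B i) by apply: measurableI => //; exact: (mB i).1.
pose V (s : seq I) := \big[setU/set0]_(i <- s) (E `&` B i).
have mV s : measurable (V s) by exact: bigsetU_measurable.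
have VE s : V s `<=` E.
  by apply: (big_ind (fun A => A `<=` E)) => [//|A A' AE AE' x [/AE|/AE']//|i _ x []//].
have finI A : measurable A -> A `<=` E -> mu A \is a fin_num.
  move=> mA AE; rewrite ge0_fin_numE//; apply: le_lt_trans (mu_I01_lty R).
  by rewrite le_measure ?inE//; exact: subset_trans EI.
have iE A f : measurable A -> A `<=` E -> polar (sn p n) f ->
    mu.-integrable A (EFin \o (fun t => supportf f (G t))).
  by move=> mA AE Kf; apply: integrableS (iG _ _ Kf) => //; exact: subset_trans EI.
(* Induction on duplicate-free lists of indices adds one piece at a time, disjoint from the earlier
   ones. *)
have appV s : uniq s -> approximable (sn p n) (e' * fine (mu (V s)))
    (fun f => \int[mu]_(t in V s) supportf f (G t)).
  elim: s => [_|i s IH /= /andP[ns us]].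
    rewrite /V big_nil; apply: approximable_small => // f Kf.
    by rewrite Rintegral_set0 measure0 normr0 mulr0.
  have disj : E `&` B i `&` V s = set0.
    rewrite /V -bigcup_seq setI_bigcupr -subset0 => t [j /= js [[_ Bi] [_ Bj]]].
    have ij : i != j by apply: contra ns => /eqP ->.
    by have := dB _ _ ij; rewrite -subset0 => /(_ t (conj Bi Bj)).
  have VS : V (i :: s) = (E `&` B i) `|` V s by rewrite /V big_cons.
  have piece := approximable_piece cG (ltW e'0) (mBi i)
    (subset_trans (@subIsetl _ _ _) EI) (iG n) (fun x y Bx By => cB i x y Bx.2 By.2).
  apply: approximable_eq (approximableD sq piece (IH us)).
    rewrite VS -mulrDr -fineD; try by apply: finI => //; exact: subIsetl.
    by rewrite measureU.
  move=> f Kf; rewrite VS Rintegral_setU//; last by apply/disj_setPS; rewrite disj.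
  apply: iE => //; first exact: measurableU.
  by move=> x [[]|/VE].
pose W := V (index_enum I).
have mW : measurable W by exact: mV.
have mEW : measurable (E `\` W) by exact: measurableD.
(* The remainder has measure below [d], so uniform integrability makes its integral small on the
   whole polar, and the set reduced to 0 approximates it. *)
have rest : approximable (sn p n) (e / 2) (fun f => \int[mu]_(t in E `\` W) supportf f (G t)).
  apply: approximable_small => // f Kf.
  have EW : E `\` W `<=` E by exact: subDsetl.
  have ie := iE _ _ mEW EW Kf.
  rewrite -lee_fin EFin_normr_Rintegral//.
  apply: le_trans (le_abse_integral _ _ _) _ => //; first exact: measurable_int ie.
  apply: ltW; apply: hd => //; last by exists f.
    exact: subset_trans EI.
  apply: le_lt_trans muB; rewrite le_measure ?inE//.
    by apply: measurableD => //; apply: bigsetU_measurable => i _; exact: (mB i).1.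
  move=> t [Et nW]; split; first exact: EI.
  rewrite -bigcup_seq => -[i _ Bi]; apply: nW; rewrite /W /V -bigcup_seq.
  by exists i => //=; rewrite mem_index_enum.
have := approximableD sq (appV _ (index_enum_uniq I)) rest.
apply: approximable_eq; last first.
  move=> f Kf; rewrite -[in RHS](setUIDK E W) Rintegral_setU//.
  - by rewrite setIidr//; exact: VE.
  - by rewrite setIidr//; exact: VE.
  - by apply: iE => //; rewrite setUIDK.
  - by apply/disj_setPS => x [[]] _ Wx [].
have : fine (mu W) <= c.
  rewrite fine_le//; last by rewrite le_measure ?inE//; exact: subset_trans (VE _) EI.
  - exact: finI (VE _).
  - by rewrite ge0_fin_numE// mu_I01_lty.
move=> Wc; have : e' * (c + 1) = e / 2 by rewrite /e' divfK// gt_eqF//; lra.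
rewrite -/W; nra.
Qed.

End pettis.

Theorem theorem4p4 (R : realType) (X : lmodType R) (p : nat -> X -> R)
  (G : lebT R -> set X) :
  frechet_seminorms p ->
  (forall t, @I01 R t -> ck p (G t)) ->
  bochner_measurable p G ->
  (pettis_integrable_ck p G <->
   forall K : set (X -> R), equicont_dual p K ->
     uniformly_integrable [set (fun t => supportf f (G t)) | f in K]).
Proof.
move=> fp cG bG; split => [PG K eK|]; first exact: pettis_uniformly_integrable eK.
exact: uniformly_integrable_pettis.
Qed.
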